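(* For any increasing function $f:(0,\infty)\to(0,\infty)$ with $f(t)\to\infty$ as $t\to\infty$, there exists an extended CMV matrix $\mathcal{E}$ having pure point spectrum, exponentially decaying eigenvectors, and satisfying $$\limsup_{t\to\infty}\frac{f(t)}{t^2}\,\|X\mathcal{E}^t\delta_0\|^2=\infty,$$ where $t$ ranges over the positive integers.
   Context: $\{\delta_n\}_{n\in\mathbb{Z}}$ is the standard basis of $\ell^2(\mathbb{Z})$ and $\mathbb{D}=\{z\in\mathbb{C}:|z|<1\}$. Given coefficients $\alpha_n\in\mathbb{D}$, $n\in\mathbb{Z}$, the associated extended CMV (ECMV) matrix is the unitary operator $\mathcal{E}=\mathcal{L}\mathcal{M}$ on $\ell^2(\mathbb{Z})$, where $$\mathcal{L}=\bigoplus_{n\in\mathbb{Z}}\Theta(\alpha_{2n}),\qquad \mathcal{M}=\bigoplus_{n\in\mathbb{Z}}\Theta(\alpha_{2n+1}),\qquad \Theta(\alpha)=\begin{bmatrix}\overline{\alpha}&\rho\\ \rho&-\alpha\end{bmatrix},\quad \rho=\sqrt{1-|\alpha|^2},$$ with the convention that $\Theta(\alpha_j)$ acts on the subspace $\ell^2(\{j,j+1\})$ (in the basis $\delta_j,\delta_{j+1}$). Pure point spectrum with exponentially decaying eigenvectors means that $\ell^2(\mathbb{Z})$ has an orthonormal basis of eigenvectors $\varphi$ of $\mathcal{E}$, each satisfying $|\varphi(n)|\le Ce^{-c|n|}$ for all $n$ with some constants $C,c>0$ depending on $\varphi$. The position operator is $[X\psi](n)=n\psi(n)$ with domain $D(X)=\{\psi\in\mathbb{C}^{\mathbb{Z}}:\sum_n|n\psi(n)|^2<\infty\}$.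 *)

(* Defs.v *)
From HB Require Import structures.
From mathcomp Require Import all_boot all_order all_algebra.
From mathcomp Require Import all_classical all_reals all_analysis.
From mathcomp Require Import complex.

Set Implicit Arguments.
Unset Strict Implicit.
Unset Printing Implicit Defensive.

Import Order.TTheory GRing.Theory Num.Theory.
Import numFieldNormedType.Exports.

Local Open Scope classical_set_scope.
Local Open Scope ring_scope.
Local Open Scope complex_scope.

Section Defs.
Variable R : realType.
Local Notation C := R[i].
Local Notation vect := (int -> C).

Definition cabs (z : C) : R := Normc.normc z.

(* The squared norm on l^2(Z); it is +oo exactly off l^2(Z). *)
Definition l2sq (psi : vect) : \bar R :=
  \esum_(n in [set: int]) (cabs (psi n) ^+ 2)%:E.

Definition in_l2 (psi : vect) : Prop := (l2sq psi < +oo)%E.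

(* The k-th partial sum runs over -k, ..., k-1, since Negz k is -(k+1). This
   is the usual sum when u is absolutely summable, which is always the case
   in l2dot for arguments in l^2(Z). *)
Definition sumZ (u : int -> R) : R :=
  limn (series (fun k : nat => u (Posz k) + u (Negz k))).

Definition l2dot (phi psi : vect) : C :=
  sumZ (fun n => complex.Re (conjc (phi n) * psi n)) +i*
  sumZ (fun n => complex.Im (conjc (phi n) * psi n)).

(* Orthonormal, with dense linear span. As l^2(Z) is separable and infinite
   dimensional, all its orthonormal bases can be indexed by nat. *)
Definition orthonormal_basis (phi : nat -> vect) : Prop :=
  [/\ forall k, in_l2 (phi k),
      forall j k, l2dot (phi j) (phi k) = (j == k)%:R
    & forall psi, in_l2 psi -> forall eps : R, 0 < eps ->
        exists (m : nat) (c : nat -> C),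
          (l2sq (fun n => psi n - \sum_(k < m) c k * phi k n)%R < (eps ^+ 2)%:E)%E].

Definition delta (m : int) : vect := fun n => (n == m)%:R.

Definition position (psi : vect) : vect := fun n => n%:~R * psi n.

Definition rho (a : C) : R := Num.sqrt (1 - cabs a ^+ 2).

Definition Theta (a : C) : 'M[C]_2 :=
  \matrix_(i < 2, j < 2)
    if i == 0 then (if j == 0 then conjc a else (rho a)%:C)
    else (if j == 0 then (rho a)%:C else - a).

(* The direct sum of the blocks Theta (alpha j), acting on the coordinates j
   and j + 1, over the integers j such that start j; here start must select
   the integers of one parity. *)
Definition Theta_sum (start : pred int) (alpha psi : vect) : vect := fun n =>
  if start n then
    Theta (alpha n) 0 0 * psi n + Theta (alpha n) 0 1 * psi (n + 1)
  else
    Theta (alpha (n - 1)) 1 0 * psi (n - 1) + Theta (alpha (n - 1)) 1 1 * psi n.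

Definition cmvL : vect -> vect -> vect := Theta_sum (fun j => (2 %| j)%Z).

Definition cmvM : vect -> vect -> vect := Theta_sum (fun j => ~~ (2 %| j)%Z).

(* Being banded, the matrix acts on all sequences. *)
Definition ecmv (alpha psi : vect) : vect := cmvL alpha (cmvM alpha psi).

Definition eigenvector (T : vect -> vect) (phi : vect) : Prop :=
  [/\ in_l2 phi, exists n, phi n != 0
    & exists z : C, forall n, T phi n = z * phi n].

Definition exp_decaying (phi : vect) : Prop :=
  exists K c : R, [/\ 0 < K, 0 < c
    & forall n : int, cabs (phi n) <= K * expR (- (c * `|n|%:~R))].

Definition pure_point_exp_decaying (T : vect -> vect) : Prop :=
  exists phi : nat -> vect, orthonormal_basis phi /\
    forall k, eigenvector T (phi k) /\ exp_decaying (phi k).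

End Defs.

(* Main.v *)
Require Import Defs.
From HB Require Import structures.
From mathcomp Require Import all_boot all_order all_algebra.
From mathcomp Require Import all_classical all_reals all_analysis.
From mathcomp Require Import complex.
From mathcomp Require Import zify ring lra.

Import Order.TTheory GRing.Theory Num.Theory.
Import numFieldNormedType.Exports.

Local Open Scope classical_set_scope.
Local Open Scope ring_scope.
Local Open Scope complex_scope.

(** The coefficients are real, odd under [n |-> - n - 1], equal in consecutive
    pairs, and tend to [1] at [+oo] (so to [-1] at [-oo]) through a staircase
    with very long steps. Localization comes from the limit, transport from the steps.

    Localization. For real coefficients [L] and [M] are selfadjoint involutions,
    so that [E + 1 = L (L + M)] and [(L + M)^2 = 2 + E + E^-1]. The operator
    [L + M] is a Jacobi matrix ([jac]) whose entries tend to [0] with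
    [rho (alpha n)] and [alpha n - alpha (n - 1)]; hence [E + 1] is compact. As
    [E] is unitary, eigenvectors found greedily by maximizing the norm of [E + 1]
    form an orthonormal basis as soon as the range of [E + 1] is dense
    ([spectral_theorem]), and density is an explicit computation with the Jacobi
    matrix, for which the coefficients come in pairs ([range_dense]). The
    eigenvalues are then different from [-1], and an eigenvector satisfies
    [(L + M) phi = (1 + z) L phi] with the entries on the left tending to [0],
    which forces exponential decay ([eigenvector_decay]).

    Transport. If the coefficients are constant from some point on, then
    [(L + M) v = s v] is, far out, the recursion [v'' = (s / rho) v' - v], whose
    solutions are bounded when [0 < s <= rho]. They give bounded formal
    eigenfunctions of [E] for a whole arc of [z] with [s^2 = 2 + z + 1/z]
    ([wave_eigen], [wave_bounded]). A packet of such waves, taken at the [N]-th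
    roots of unity in the arc and normalized, has by Parseval's identity a bounded
    total mass at each site over [N] steps ([parseval]). Its overlap with the
    evolving [delta 0] is conserved and bounded below, so a fixed part of
    [E^t delta_0] is at a distance of order [t] for some [t] of order [N]
    ([ballistic]).

    Combination. A single step of the staircase, continued for ever, therefore
    has [f t / t^2 * ||X E^t delta_0||^2] large for some large [t], because
    [f] tends to infinity. Up to that time the evolution depends on finitely many
    coefficients only ([iter_agree]), so the next step can start beyond them
    without being noticed ([staircase]). *)

Set Implicit Arguments.
Unset Strict Implicit.
Unset Printing Implicit Defensive.

(** * Squared moduli and symmetric partial sums *)

Section SquaredModulus.
Context {R : realType}.
Implicit Types z w : R[i].

Definition sqm z : R := complex.Re z ^+ 2 + complex.Im z ^+ 2.

Lemma complexP z w : complex.Re z = complex.Re w -> complex.Im z = complex.Im w -> z = w.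
Proof. by case: z w => a b [c d] /= -> ->. Qed.

Lemma sqm_ge0 z : 0 <= sqm z.
Proof. by rewrite /sqm addr_ge0 ?sqr_ge0. Qed.

Lemma cabs2E z : cabs z ^+ 2 = sqm z.
Proof. by case: z => a b; rewrite /cabs /sqm /= sqr_sqrtr// addr_ge0 ?sqr_ge0. Qed.

Lemma sqm0 : sqm 0 = 0.
Proof. by rewrite /sqm /= expr0n /= addr0. Qed.

Lemma sqm1 : sqm 1 = 1.
Proof. by rewrite /sqm /= expr0n /= addr0 expr1n. Qed.

Lemma sqm_eq0 z : sqm z = 0 -> z = 0.
Proof.
case: z => a b; rewrite /sqm /= => h.
have := sqr_ge0 a; have := sqr_ge0 b => hb ha.
have /eqP : a ^+ 2 = 0 by lra.
have /eqP : b ^+ 2 = 0 by lra.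
by rewrite !expf_eq0 /= => /eqP -> /eqP ->.
Qed.

Lemma sqmM z w : sqm (z * w) = sqm z * sqm w.
Proof. by case: z w => a b [c d]; rewrite /sqm /=; ring. Qed.

Lemma sqmX z t : sqm (z ^+ t) = sqm z ^+ t.
Proof. by elim: t => [|t ih]; rewrite ?expr0 ?sqm1 // !exprS sqmM ih. Qed.

Lemma sqmN z : sqm (- z) = sqm z.
Proof. by case: z => a b; rewrite /sqm /=; ring. Qed.

Lemma sqm_real (x : R) : sqm x%:C = x ^+ 2.
Proof. by rewrite /sqm /= expr0n /= addr0. Qed.

Lemma sqm_conj z : sqm (conjc z) = sqm z.
Proof. by case: z => a b; rewrite /sqm /= sqrrN. Qed.

Lemma conj_mul z : conjc z * z = (sqm z)%:C.
Proof. by case: z => a b; apply: complexP; rewrite /sqm /=; ring. Qed.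

Lemma sqmD_le z w : sqm (z + w) <= 2 * sqm z + 2 * sqm w.
Proof.
case: z w => a b [c d]; rewrite /sqm /=.
have := sqr_ge0 (a - c); have := sqr_ge0 (b - d).
rewrite !expr2; nra.
Qed.

Lemma sqmD z w : sqm (z + w) = sqm z + sqm w + 2 * complex.Re (conjc z * w).
Proof. by case: z w => a b [c d]; rewrite /sqm /=; ring. Qed.

Lemma ReD z w : complex.Re (z + w) = complex.Re z + complex.Re w.
Proof. by case: z w => a b [c d]. Qed.

Lemma ImD z w : complex.Im (z + w) = complex.Im z + complex.Im w.
Proof. by case: z w => a b [c d]. Qed.

Lemma cabs_sqm z : cabs z = Num.sqrt (sqm z).
Proof. by case: z. Qed.

Lemma conjD z w : conjc (z + w) = conjc z + conjc w.
Proof. by case: z w => a b [c d]; apply: complexP => //=; ring. Qed.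

Lemma conjN z : conjc (- z) = - conjc z.
Proof. by case: z. Qed.

Lemma conjM z w : conjc (z * w) = conjc z * conjc w.
Proof. by case: z w => a b [c d]; apply: complexP => /=; ring. Qed.

End SquaredModulus.

Section SymmetricSums.
Context {V : zmodType}.
Implicit Types (u v : int -> V).

(** The partial sums in the definition of [sumZ]; they run over [- N <= n < N]. *)
Definition psum u (N : nat) : V := \sum_(0 <= k < N) (u (Posz k) + u (Negz k)).

Lemma psum0 u : psum u 0 = 0.
Proof. by rewrite /psum big_geq. Qed.

Lemma psumS u N : psum u N.+1 = psum u N + (u (Posz N) + u (Negz N)).
Proof. by rewrite /psum big_nat_recr. Qed.

Lemma psumD u v N : psum (fun n => u n + v n) N = psum u N + psum v N.
Proof. by rewrite /psum -big_split /=; apply: eq_bigr => k _; rewrite addrACA. Qed.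

Lemma psumN u N : psum (fun n => - u n) N = - psum u N.
Proof. by rewrite /psum -sumrN; apply: eq_bigr => k _; rewrite opprD. Qed.

Lemma psumB u v N : psum (fun n => u n - v n) N = psum u N - psum v N.
Proof. by rewrite psumD psumN. Qed.

Lemma eq_psum u v N : u =1 v -> psum u N = psum v N.
Proof. by move=> e; apply: eq_bigr => k _; rewrite !e. Qed.

Lemma psum_sum (I : Type) (s : seq I) (F : I -> int -> V) N :
  psum (fun n => \sum_(i <- s) F i n) N = \sum_(i <- s) psum (F i) N.
Proof. by rewrite /psum exchange_big /=; apply: eq_bigr => k _; rewrite big_split. Qed.

Lemma psum_telescope u N :
  psum (fun n => u n - u (n - 1)) N = u (Posz N - 1) - u (- Posz N - 1).
Proof.
elim: N => [|N ih]; first by rewrite psum0 oppr0 sub0r subrr.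
rewrite psumS ih.
have -> : Posz N.+1 - 1 = N by lia.
have -> : - Posz N.+1 - 1 = Negz N - 1 by lia.
have -> : - Posz N - 1 = Negz N by lia.
by rewrite addrCA [X in _ + X]addrA subrK addrA subrK.
Qed.

Lemma psum_shift u N :
  psum (fun n => u (n + 1)) N = psum u N + (u (Posz N) - u (- Posz N)).
Proof.
have := psum_telescope (fun n => u (n + 1)) N.
rewrite psumB !subrK => /eqP; rewrite subr_eq => /eqP ->.
rewrite [LHS]addrC; congr (_ + _); apply: eq_psum => n /=; by rewrite subrK.
Qed.

Lemma psum_delta m (u : int -> V) N : (forall n, n != m -> u n = 0) -> (`|m|%N < N)%N ->
  psum u N = u m.
Proof.
move=> h hm; rewrite /psum big_mkord.
case: m h hm => k h hk.
  rewrite (bigD1 (Ordinal hk))//= [u (Negz k)]h// addr0 big1 ?addr0// => j hj.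
  rewrite !h ?addr0// eqz_nat; apply: contra hj => /eqP e; exact/eqP/val_inj.
have hk' : (k < N)%N by lia.
rewrite (bigD1 (Ordinal hk'))//= [u (Posz k)]h// add0r big1 ?addr0// => j hj.
rewrite !h ?addr0//; apply: contra hj => /eqP [e]; exact/eqP/val_inj.
Qed.

End SymmetricSums.

(** * Summable families over the integers *)

Section SumsOverZ.
Context {R : realType}.
Implicit Types (u v : int -> R).

Definition summ u := exists B : R, forall N, psum (fun n => `|u n|) N <= B.

Lemma le_psum u v N : (forall n, u n <= v n) -> psum u N <= psum v N.
Proof. by move=> h; apply: ler_sum => k _; apply: lerD. Qed.

Lemma psum_ge0 u N : (forall n, 0 <= u n) -> 0 <= psum u N.
Proof. by move=> h; apply: sumr_ge0 => k _; apply: addr_ge0. Qed.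

Lemma psum_nd u : (forall n, 0 <= u n) -> nondecreasing_seq (psum u).
Proof.
move=> h; apply/nondecreasing_seqP => N.
by rewrite psumS lerDl addr_ge0.
Qed.

Lemma psumZ a u N : psum (fun n => a * u n) N = a * psum u N.
Proof. by rewrite /psum mulr_sumr; apply: eq_bigr => k _; rewrite mulrDr. Qed.

Lemma psum_cvg_ge0 u B : (forall n, 0 <= u n) -> (forall N, psum u N <= B) ->
  psum u @ \oo --> sumZ u.
Proof.
move=> h hB; have hc : cvgn (psum u).
  apply: (nondecreasing_is_cvgn (psum_nd h)).
  by exists B => _ [N _ <-].
exact: hc.
Qed.

Lemma sumZ_lim u (l : R) : psum u @ \oo --> l -> sumZ u = l.
Proof. by move=> h; apply: (cvg_lim _ h). Qed.

Lemma cvgn_ext (f g : nat -> R) (l : R) : f =1 g -> f @ \oo --> l -> g @ \oo --> l.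
Proof. by move=> /funext ->. Qed.

Lemma cvgn0P (f : nat -> R) : f @ \oo --> (0 : R) <->
  forall e, 0 < e -> exists N, forall n, (N <= n)%N -> `|f n| < e.
Proof.
split=> [/cvgrPdist_lt h e e0|h].
  by have [N _ hN] := h e e0; exists N => n /hN; rewrite sub0r normrN.
apply/cvgrPdist_lt => e e0; have [N hN] := h e e0.
by exists N => // n /= /hN; rewrite sub0r normrN.
Qed.

Lemma summ_cvg u : summ u -> psum u @ \oo --> sumZ u.
Proof.
move=> [B hB].
have h1 := psum_cvg_ge0 (fun n => normr_ge0 (u n)) hB.
have h2 : psum (fun n => u n + `|u n|) @ \oo --> sumZ (fun n => u n + `|u n|).
  apply: (@psum_cvg_ge0 _ (2 * B)) => [n|N].
    by have := ler_norm (- u n); rewrite normrN; lra.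
  apply: le_trans (_ : 2 * psum (fun n => `|u n|) N <= _).
    rewrite -psumZ; apply: le_psum => n; have := ler_norm (u n); lra.
  by rewrite ler_wpM2l.
have h3 : psum u @ \oo --> sumZ (fun n => u n + `|u n|) - sumZ (fun n => `|u n|).
  apply: cvgn_ext (cvgB h2 h1) => N.
  rewrite fctE -psumB; apply: eq_psum => n; by rewrite addrK.
by have -> : sumZ u = _ := sumZ_lim h3.
Qed.

Lemma summ_le u v : (forall n, `|u n| <= v n) -> summ v -> summ u.
Proof.
move=> h [B hB]; exists B => N; apply: le_trans (hB N); apply: le_psum => n.
by apply: le_trans (h n) (ler_norm _).
Qed.

Lemma summ_norm u : summ u -> summ (fun n => `|u n|).
Proof. by case=> B hB; exists B => N; apply: le_trans (hB N); apply: le_psum => n; rewrite normr_id. Qed.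

Lemma summD u v : summ u -> summ v -> summ (fun n => u n + v n).
Proof.
move=> [B hB] [C hC]; exists (B + C) => N; apply: le_trans (lerD (hB N) (hC N)).
by rewrite -psumD; apply: le_psum => n; apply: ler_normD.
Qed.

Lemma summZ a u : summ u -> summ (fun n => a * u n).
Proof.
move=> [B hB]; exists (`|a| * B) => N.
apply: le_trans (ler_wpM2l (normr_ge0 a) (hB N)).
by rewrite -psumZ; apply: le_psum => n; rewrite normrM.
Qed.

Lemma sumZD u v : summ u -> summ v -> sumZ (fun n => u n + v n) = sumZ u + sumZ v.
Proof.
move=> hu hv; apply: sumZ_lim.
by apply: cvgn_ext (cvgD (summ_cvg hu) (summ_cvg hv)) => N; rewrite fctE psumD.
Qed.

Lemma sumZZ a u : summ u -> sumZ (fun n => a * u n) = a * sumZ u.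
Proof.
move=> hu; apply: sumZ_lim.
by apply: cvgn_ext (cvgMl_tmp (a := a) (summ_cvg hu)) => N; rewrite psumZ.
Qed.

Lemma eq_sumZ u v : u =1 v -> sumZ u = sumZ v.
Proof. by move=> h; congr sumZ; apply/funext. Qed.

Lemma sumZ_ge_psum u N : (forall n, 0 <= u n) -> summ u -> psum u N <= sumZ u.
Proof.
move=> h hu; have c := summ_cvg hu.
rewrite -(cvg_lim _ c)//; apply: nondecreasing_cvgn_le; first exact: psum_nd.
by apply/cvg_ex; exists (sumZ u).
Qed.

Lemma sumZ_le_bound u B : summ u -> (forall N, psum u N <= B) -> sumZ u <= B.
Proof.
move=> hu h; have c := summ_cvg hu.
rewrite -(cvg_lim _ c)//; apply: limr_le; first by apply/cvg_ex; exists (sumZ u).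
by near=> N; apply: h.
Unshelve. all: by end_near.
Qed.

Lemma le_sumZ u v : summ u -> summ v -> (forall n, u n <= v n) -> sumZ u <= sumZ v.
Proof.
move=> hu hv h; apply: (ler_lim (f := psum u) (g := psum v)).
- by apply/cvg_ex; exists (sumZ u); apply: summ_cvg.
- by apply/cvg_ex; exists (sumZ v); apply: summ_cvg.
- by near=> N; apply: le_psum.
Unshelve. all: by end_near.
Qed.

Lemma sumZ_ge0 u : summ u -> (forall n, 0 <= u n) -> 0 <= sumZ u.
Proof. by move=> hu h; rewrite -(psum0 u); apply: sumZ_ge_psum. Qed.

Lemma psum_ge_term u n N : (forall n, 0 <= u n) -> (`|n|%N < N)%N -> u n <= psum u N.
Proof.
move=> h hn; apply: le_trans (_ : psum u `|n|%N.+1 <= _); last exact: psum_nd.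
case: n hn => k hk; rewrite psumS.
  rewrite absz_nat; have := psum_ge0 k h; have := h (Negz k); lra.
apply: le_trans (_ : psum u k.+1 <= _); last first.
  by rewrite lerDl addr_ge0.
by rewrite psumS; have := psum_ge0 k h; have := h (Posz k); lra.
Qed.

Lemma sumZ_ge_term u n : (forall n, 0 <= u n) -> summ u -> u n <= sumZ u.
Proof.
move=> h hu; apply: le_trans (sumZ_ge_psum `|n|%N.+1 h hu).
exact: psum_ge_term.
Qed.

Lemma summ_term0 u : summ u ->
  (u (Posz N) @[N --> \oo] --> 0) /\ (u (Negz N) @[N --> \oo] --> 0).
Proof.
move=> hu; have hb := summ_norm hu.
have c := summ_cvg hb.
have h0 : `|u (Posz N)| + `|u (Negz N)| @[N --> \oo] --> 0.
  rewrite -(subrr (sumZ (fun n => `|u n|))).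
  have c1 : psum (fun n => `|u n|) n.+1 @[n --> \oo] --> sumZ (fun n => `|u n|).
    by rewrite (cvg_shiftS (psum (fun n => `|u n|))).
  by apply: cvgn_ext (cvgB c1 c) => N; rewrite fctE psumS addrC addKr.
by split; apply/cvgn0P => e e0; have [N hN] := (cvgn0P _).1 h0 e e0;
  exists N => n /hN; rewrite ger0_norm ?addr_ge0//; apply: le_lt_trans;
  rewrite ?lerDl ?lerDr.
Qed.

Lemma summ_shift u : summ u -> summ (fun n => u (n + 1)).
Proof.
move=> [B hB]; exists (B + B) => N.
rewrite (psum_shift (fun n => `|u n|)) lerD//.
apply: le_trans (hB N.+1); rewrite -[leRHS]addr0.
have := @psum_ge_term (fun n => `|u n|) (Posz N) N.+1 (fun n => normr_ge0 _) (ltnSn N).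
have := normr_ge0 (u (- Posz N)); rewrite /=; lra.
Qed.

Lemma sumZ_telescope u : summ u -> sumZ (fun n => u n - u (n - 1)) = 0.
Proof.
move=> hu; apply: sumZ_lim.
have [hp hn] := summ_term0 hu.
have hn1 : u (Negz n.+1) @[n --> \oo] --> 0 by rewrite (cvg_shiftS (fun n => u (Negz n))).
have h : psum (fun n => u n - u (n - 1)) n.+1 @[n --> \oo] --> (0 - 0 : R).
  apply: cvgn_ext (cvgB hp hn1) => N.
  rewrite fctE psum_telescope; congr (u _ - u _); lia.
by rewrite subr0 in h; rewrite -cvg_shiftS.
Qed.

Lemma summB u v : summ u -> summ v -> summ (fun n => u n - v n).
Proof.
move=> hu hv; apply: summD => //; apply: summ_le (summ_norm hv) => n.
by rewrite normrN.
Qed.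

Lemma sumZB u v : summ u -> summ v -> sumZ (fun n => u n - v n) = sumZ u - sumZ v.
Proof.
move=> hu hv; rewrite (@eq_sumZ _ (fun n => u n + (-1) * v n)) ?sumZD ?sumZZ//.
- by rewrite mulN1r.
- exact: summZ.
- by move=> n; rewrite mulN1r.
Qed.

Lemma sumZ_shift u : summ u -> sumZ (fun n => u (n + 1)) = sumZ u.
Proof.
move=> hu; have h1 := summ_shift hu.
apply/eqP; rewrite -subr_eq0 -sumZB//; apply/eqP.
rewrite -(sumZ_telescope h1); apply: eq_sumZ => n; by rewrite subrK.
Qed.

Lemma eq_summ u v : u =1 v -> summ u -> summ v.
Proof. by move=> /funext ->. Qed.

Lemma sumZ_tail u e : (forall n, 0 <= u n) -> summ u -> 0 < e ->
  exists N, forall M, (N <= M)%N -> sumZ u - psum u M < e.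
Proof.
move=> h hu e0; have c := summ_cvg hu.
have [N _ hN] := (cvgrPdist_lt _ _).1 c e e0; exists N => M hM.
by apply: le_lt_trans (hN M hM); apply: ler_norm.
Qed.

End SumsOverZ.

(** * Square-summable sequences *)

Section SquareSummable.
Context {R : realType}.
Local Notation C := R[i].
Local Notation vect := (int -> C).
Implicit Types (phi psi chi : vect) (a : C).

Definition sq psi : int -> R := fun n => sqm (psi n).
Definition l2 psi := summ (sq psi).
Definition nsq psi : R := sumZ (sq psi).
Definition scal a psi : vect := fun n => a * psi n.

Lemma scalN1 psi : - psi = scal (-1) psi.
Proof. by apply/funext => n; rewrite /scal fctE mulN1r. Qed.

Lemma scalD a phi psi : scal a (phi + psi) = scal a phi + scal a psi.
Proof. by apply/funext => n; rewrite /scal !fctE mulrDr. Qed.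

Lemma scalA a a' psi : scal a (scal a' psi) = scal (a * a') psi.
Proof. by apply/funext => n; rewrite /scal mulrA. Qed.

Lemma scal0 psi : scal 0 psi = 0.
Proof. by apply/funext => n; rewrite /scal mul0r. Qed.

Lemma scal1 psi : scal 1 psi = psi.
Proof. by apply/funext => n; rewrite /scal mul1r. Qed.

Lemma sq_ge0 psi n : 0 <= sq psi n. Proof. exact: sqm_ge0. Qed.

Lemma l2sq_nneseries psi :
  l2sq psi = (\sum_(0 <= k <oo) (sq psi (Posz k) + sq psi (Negz k))%:E)%E.
Proof.
have h0 n : (0 <= (sq psi n)%:E)%E by rewrite lee_fin sq_ge0.
have -> : l2sq psi = (\esum_(n in [set: int]) (sq psi n)%:E)%E.
  by apply: eq_esum => n _; rewrite cabs2E.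
rewrite (esumID (range Posz))//.
have -> : [set: int] `&` range Posz = [set Posz n | n in [set: nat]] by rewrite setTI.
have -> : [set: int] `&` ~` range Posz = [set Negz n | n in [set: nat]].
  rewrite setTI; apply/seteqP; split => [[k|k] /= h|_ [k _ <-] [j _ //]].
    by exfalso; apply: h; exists k.
  by exists k.
rewrite !esum_image; [|by move=> x y _ _ [] |by move=> x y _ _ []].
rewrite -esumD// -nneseries_esumT//.
by move=> k; rewrite adde_ge0.
Qed.

Lemma psum_le_l2sq psi N : ((psum (sq psi) N)%:E <= l2sq psi)%E.
Proof.
rewrite l2sq_nneseries -sumEFin; apply: nneseries_lim_ge => k _ _.
by rewrite lee_fin addr_ge0 ?sq_ge0.
Qed.

Lemma l2_psum psi B : (forall N, psum (sq psi) N <= B) -> l2 psi.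
Proof.
move=> h; exists B => N; apply: le_trans (h N); apply: le_psum => n.
by rewrite ger0_norm ?sq_ge0.
Qed.

Lemma in_l2E psi : in_l2 psi -> l2 psi.
Proof.
move=> h; have h0 := psum_le_l2sq psi.
have e : l2sq psi = (fine (l2sq psi))%:E.
  rewrite fineK// ge0_fin_numE//.
  by apply: le_trans (h0 0%N); rewrite psum0.
by apply: (@l2_psum _ (fine (l2sq psi))) => N; rewrite -lee_fin -e.
Qed.

Lemma l2sqE psi : l2 psi -> l2sq psi = (nsq psi)%:E.
Proof.
move=> h; rewrite l2sq_nneseries.
apply/cvg_lim => //; rewrite [X in X @ _](_ : _ = EFin \o psum (sq psi)).
  by apply: cvg_EFin; [near=> n|exact: summ_cvg].
by apply/funext => N /=; rewrite /psum -sumEFin.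
Unshelve. all: by end_near.
Qed.

Lemma l2_in_l2 psi : l2 psi -> in_l2 psi.
Proof. by move=> h; rewrite /in_l2 l2sqE// ltry. Qed.

Lemma nsq_ge0 psi : l2 psi -> 0 <= nsq psi.
Proof. by move=> h; apply: sumZ_ge0 => // n; apply: sq_ge0. Qed.

Lemma sq_le_nsq psi n : l2 psi -> sq psi n <= nsq psi.
Proof. by move=> h; apply: (sumZ_ge_term n) => // k; apply: sq_ge0. Qed.

Lemma psum_le_nsq psi N : l2 psi -> psum (sq psi) N <= nsq psi.
Proof. by move=> h; apply: sumZ_ge_psum => // n; apply: sq_ge0. Qed.

Lemma nsq_le psi B : l2 psi -> (forall N, psum (sq psi) N <= B) -> nsq psi <= B.
Proof. exact: sumZ_le_bound. Qed.

Lemma nsq_eq0 psi : l2 psi -> nsq psi = 0 -> psi = 0.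
Proof.
move=> h e; apply/funext => n; apply: sqm_eq0; apply/eqP.
by rewrite eq_le sqm_ge0 andbT -e sq_le_nsq.
Qed.

Lemma l2D phi psi : l2 phi -> l2 psi -> l2 (phi + psi).
Proof.
move=> h1 h2; apply: summ_le (summD (summZ 2 h1) (summZ 2 h2)) => n.
by rewrite ger0_norm ?sq_ge0//; apply: sqmD_le.
Qed.

Lemma l2Z a psi : l2 psi -> l2 (scal a psi).
Proof.
move=> h; apply: summ_le (summZ (sqm a) h) => n.
by rewrite ger0_norm ?sq_ge0// /sq /scal sqmM.
Qed.

Lemma l2N psi : l2 psi -> l2 (- psi).
Proof. by apply: eq_summ => n; rewrite /sq fctE sqmN. Qed.

Lemma l2B phi psi : l2 phi -> l2 psi -> l2 (phi - psi).
Proof. by move=> h1 h2; apply: l2D => //; apply: l2N. Qed.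

Lemma l20 : l2 0.
Proof.
by apply: (@l2_psum _ 0) => N; rewrite /psum big1// => k _; rewrite /sq -[(0 : vect) _]/0 -[(0 : vect) (Negz _)]/0 sqm0 addr0.
Qed.

Lemma l2_sum (I : Type) (s : seq I) (P : pred I) (f : I -> vect) :
  (forall i, P i -> l2 (f i)) -> l2 (\sum_(i <- s | P i) f i).
Proof. by move=> h; elim/big_rec: _ => [|i x Pi hx]; [exact: l20|apply: l2D => //; apply: h]. Qed.

Lemma summ_Re phi psi : l2 phi -> l2 psi ->
  summ (fun n => complex.Re (conjc (phi n) * psi n)).
Proof.
move=> h1 h2; apply: summ_le (summD h1 h2) => n; rewrite /sq.
case: (phi n) (psi n) => a b [c d]; rewrite /sqm /= ler_norml.
have := sqr_ge0 (a - c); have := sqr_ge0 (b - d).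
have := sqr_ge0 (a + c); have := sqr_ge0 (b + d).
rewrite !expr2 => *; apply/andP; split; nra.
Qed.

Lemma summ_Im phi psi : l2 phi -> l2 psi ->
  summ (fun n => complex.Im (conjc (phi n) * psi n)).
Proof.
move=> h1 h2; apply: summ_le (summD h1 h2) => n; rewrite /sq.
case: (phi n) (psi n) => a b [c d]; rewrite /sqm /= ler_norml.
have := sqr_ge0 (a - d); have := sqr_ge0 (b - c).
have := sqr_ge0 (a + d); have := sqr_ge0 (b + c).
rewrite !expr2 => *; apply/andP; split; nra.
Qed.

Lemma dotDr phi psi chi : l2 phi -> l2 psi -> l2 chi ->
  l2dot phi (psi + chi) = l2dot phi psi + l2dot phi chi.
Proof.
move=> h1 h2 h3; apply: complexP; rewrite /= -sumZD; try exact: summ_Re; try exact: summ_Im.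
  by apply: eq_sumZ => n; rewrite fctE mulrDr ReD.
by apply: eq_sumZ => n; rewrite fctE mulrDr ImD.
Qed.

Lemma dotZr a phi psi : l2 phi -> l2 psi ->
  l2dot phi (scal a psi) = a * l2dot phi psi.
Proof.
move=> h1 h2; have hr := summ_Re h1 h2; have hi := summ_Im h1 h2.
case: a => x y; apply: complexP => /=.
  rewrite -!sumZZ// -sumZB; try exact: summZ.
  apply: eq_sumZ => n; rewrite /scal.
  by case: (phi n) (psi n) => a b [c d] /=; ring.
rewrite -!sumZZ// -sumZD; try exact: summZ.
apply: eq_sumZ => n; rewrite /scal.
by case: (phi n) (psi n) => a b [c d] /=; ring.
Qed.

Lemma dotC phi psi : l2 phi -> l2 psi -> l2dot psi phi = conjc (l2dot phi psi).
Proof.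
move=> h1 h2; apply: complexP => /=.
  by apply: eq_sumZ => n; case: (phi n) (psi n) => a b [c d] /=; ring.
have := sumZZ (-1) (summ_Im h1 h2); rewrite mulN1r => <-.
by apply: eq_sumZ => n; case: (phi n) (psi n) => a b [c d] /=; ring.
Qed.

Lemma dotNr phi psi : l2 phi -> l2 psi -> l2dot phi (- psi) = - l2dot phi psi.
Proof.
move=> h1 h2; rewrite -[RHS]mulN1r -dotZr//; congr l2dot.
by apply/funext => n; rewrite /scal mulN1r fctE.
Qed.

Lemma dotBr phi psi chi : l2 phi -> l2 psi -> l2 chi ->
  l2dot phi (psi - chi) = l2dot phi psi - l2dot phi chi.
Proof. by move=> h1 h2 h3; rewrite dotDr ?dotNr//; apply: l2N. Qed.

Lemma dotDl phi psi chi : l2 phi -> l2 psi -> l2 chi ->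
  l2dot (psi + chi) phi = l2dot psi phi + l2dot chi phi.
Proof.
move=> h1 h2 h3; rewrite dotC//; last exact: l2D.
by rewrite dotDr// conjD -!dotC.
Qed.

Lemma dotZl a phi psi : l2 phi -> l2 psi ->
  l2dot (scal a psi) phi = conjc a * l2dot psi phi.
Proof.
move=> h1 h2; rewrite dotC//; last exact: l2Z.
by rewrite dotZr// conjM -dotC.
Qed.

Lemma dot0r phi : l2 phi -> l2dot phi 0 = 0.
Proof.
move=> h; have := dotBr h h h; rewrite !subrr => <-.
by congr l2dot.
Qed.

Lemma dot0l phi : l2 phi -> l2dot 0 phi = 0.
Proof. by move=> h; rewrite dotC ?dot0r ?conjc0//; exact: l20. Qed.

Lemma dot_sumr (I : Type) (s : seq I) (P : pred I) (f : I -> vect) phi :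
  l2 phi -> (forall i, P i -> l2 (f i)) ->
  l2dot phi (\sum_(i <- s | P i) f i) = \sum_(i <- s | P i) l2dot phi (f i).
Proof.
move=> h hf.
suff [] : l2 (\sum_(i <- s | P i) f i) /\
    l2dot phi (\sum_(i <- s | P i) f i) = \sum_(i <- s | P i) l2dot phi (f i) by [].
elim/big_rec2: _ => [|i x y Pi [hx ex]]; first by split; [exact: l20|exact: dot0r].
by split; [apply: l2D => //; apply: hf|rewrite dotDr ?ex//; apply: hf].
Qed.

Lemma dot_self psi : l2 psi -> l2dot psi psi = (nsq psi)%:C.
Proof.
move=> h; apply: complexP => /=.
  by apply: eq_sumZ => n; rewrite conj_mul.
rewrite -[RHS](mul0r (nsq psi)) -sumZZ//; apply: eq_sumZ => n.
by rewrite conj_mul mul0r.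
Qed.

Lemma nsqD phi psi : l2 phi -> l2 psi ->
  nsq (phi + psi) = nsq phi + nsq psi + 2 * complex.Re (l2dot phi psi).
Proof.
move=> h1 h2; have h3 := summ_Re h1 h2.
rewrite /= -sumZZ// -!sumZD//; try exact: summD; try exact: summZ.
by apply: eq_sumZ => n; rewrite /sq fctE sqmD.
Qed.

Lemma nsqZ a psi : l2 psi -> nsq (scal a psi) = sqm a * nsq psi.
Proof. by move=> h; rewrite -sumZZ//; apply: eq_sumZ => n; rewrite /sq sqmM. Qed.

Lemma nsqN psi : nsq (- psi) = nsq psi.
Proof. by apply: eq_sumZ => n; rewrite /sq fctE sqmN. Qed.

Lemma nsqD_le phi psi : l2 phi -> l2 psi -> nsq (phi + psi) <= 2 * nsq phi + 2 * nsq psi.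
Proof.
move=> h1 h2; rewrite -!sumZZ// -sumZD; try exact: summZ.
apply: le_sumZ; [exact: l2D|by apply: summD; apply: summZ|].
by move=> n; apply: sqmD_le.
Qed.

Lemma nsq0 : nsq 0 = 0.
Proof.
have -> : (0 : vect) = scal 0 0 by apply/funext => n; rewrite /scal mul0r.
by rewrite nsqZ ?sqm0 ?mul0r//; exact: l20.
Qed.

(** The difference of the two inner products telescopes, and its boundary terms
    vanish at both ends because [w] is summable. *)
Lemma dot_adjoint phi psi phi' psi' (w : int -> C) :
  l2 phi -> l2 psi -> l2 phi' -> l2 psi' ->
  summ (fun n => complex.Re (w n)) -> summ (fun n => complex.Im (w n)) ->
  (forall n, conjc (phi n) * psi' n - conjc (phi' n) * psi n = w n - w (n - 1)) ->
  l2dot phi psi' = l2dot phi' psi.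
Proof.
move=> h1 h2 h3 h4 hr hi e; apply: complexP => /=; apply/eqP; rewrite -subr_eq0.
  rewrite -sumZB; try exact: summ_Re.
  rewrite -(sumZ_telescope hr); apply/eqP; apply: eq_sumZ => n.
  by have := congr1 (@complex.Re R) (e n); rewrite !(ReD, ReD) /= !raddfN.
rewrite -sumZB; try exact: summ_Im.
rewrite -(sumZ_telescope hi); apply/eqP; apply: eq_sumZ => n.
by have := congr1 (@complex.Im R) (e n); rewrite !(ImD, ImD) /= !raddfN.
Qed.

Lemma l2_delta m : l2 (delta R m).
Proof.
apply: (@l2_psum _ 1) => N; apply: le_trans (_ : psum (sq (delta R m)) (N + `|m|.+1) <= _).
  by apply: psum_nd; [exact: sq_ge0|lia].
rewrite (@psum_delta _ m); last by lia.
  by rewrite /sq /delta eqxx sqm1.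
by move=> n /negbTE hn; rewrite /sq /delta hn sqm0.
Qed.

Lemma sumZ_delta m (u : int -> R) : (forall n, n != m -> u n = 0) -> sumZ u = u m.
Proof.
move=> h; apply: sumZ_lim; rewrite -(cvg_shiftn `|m|.+1).
rewrite [X in X @ _](_ : _ = fun=> u m); first exact: cvg_cst.
by apply/funext => N /=; apply: psum_delta => //; lia.
Qed.

Lemma dot_delta m psi : l2dot (delta R m) psi = psi m.
Proof.
by apply: complexP; rewrite /= (@sumZ_delta m)
  => [|n /negbTE hn]; rewrite /delta ?eqxx ?hn ?conjc1 ?conjc0 ?mul1r ?mul0r.
Qed.

Lemma nsq_delta m : nsq (delta R m) = 1.
Proof.
rewrite /nsq (@sumZ_delta m) => [|n /negbTE hn]; rewrite /sq /delta ?eqxx ?sqm1//.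
by rewrite hn sqm0.
Qed.

End SquareSummable.

(** * Direct sums of reflections *)

Section Reflections.
Context {R : realType}.
Local Notation C := R[i].
Local Notation vect := (int -> C).
Implicit Types (phi psi chi : vect) (c : C) (a : int -> R) (start : pred int).

Definition rr a n : R := Num.sqrt (1 - a n ^+ 2).

Definition refl start a psi : vect := fun n =>
  if start n then (a n)%:C * psi n + (rr a n)%:C * psi (n + 1)
  else (rr a (n - 1))%:C * psi (n - 1) - (a (n - 1))%:C * psi n.

Definition parity_like start := forall n, start (n + 1) = ~~ start n.

Lemma parity_like_pred start n : parity_like start -> start (n - 1) = ~~ start n.
Proof. by move=> h; have := h (n - 1); rewrite subrK => ->; rewrite negbK. Qed.

Lemma even_parity_like : parity_like (fun j => (2 %| j)%Z).
Proof. by move=> n; lia. Qed.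

Lemma odd_parity_like : parity_like (fun j => ~~ (2 %| j)%Z).
Proof. by move=> n; lia. Qed.

Lemma Theta_sum_real start a : Theta_sum start (fun n => (a n)%:C) = refl start a.
Proof.
apply/funext => psi; apply/funext => n.
have hr m : rho (a m)%:C = rr a m.
  by rewrite /rho cabs2E sqm_real.
rewrite /Theta_sum /refl /Theta !mxE -[0 == 0]/true -[1 == 0]/false !hr conjc_real.
by case: (start n); rewrite ?mulNr.
Qed.

Section Alternating.
Variables (start : pred int) (a : int -> R).
Hypothesis alt : parity_like start.

Lemma reflD phi psi : refl start a (phi + psi) = refl start a phi + refl start a psi.
Proof.
apply/funext => n; rewrite /refl !fctE; case: (start n); first by ring.
by ring.
Qed.

Lemma reflZ c psi : refl start a (scal c psi) = scal c (refl start a psi).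
Proof. by apply/funext => n; rewrite /refl /scal; case: (start n); ring. Qed.

(** The current through the bond between [n] and [n + 1], whose discrete
    divergence is the defect of symmetry of [refl]. It serves both for
    square-summable sequences and for sums over finite windows. *)
Definition flux phi psi n : C :=
  if start n then (rr a n)%:C * (conjc (phi n) * psi (n + 1) - conjc (phi (n + 1)) * psi n)
  else 0.

Lemma refl_flux phi psi n :
  conjc (phi n) * refl start a psi n - conjc (refl start a phi n) * psi n =
  flux phi psi n - flux phi psi (n - 1).
Proof.
rewrite /flux parity_like_pred// if_neg subrK /refl.
by case: (start n); rewrite ?(conjD, conjN, conjM, conjc_real); ring.
Qed.

Lemma l2_shift psi : l2 psi -> l2 (fun n => psi (n + 1)).
Proof. by move=> h; apply: eq_summ (summ_shift h). Qed.

Lemma l2_shiftN psi : l2 psi -> l2 (fun n => psi (n - 1)).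
Proof.
case=> B hB; exists (B + B) => N; apply: le_trans (_ : psum (fun n => `|sq psi n|) N.+1 <= _); last first.
  by apply: le_trans (hB _) _; rewrite lerDl; apply: le_trans (hB 0%N); rewrite psum0.
have := psum_telescope (fun n => `|sq psi n|) N; rewrite psumB => e.
rewrite psumS; set x := psum _ _ in e *.
have -> : psum (fun n => `|sq (fun n0 => psi (n0 - 1)) n|) N = x - (`|sq psi (N%:Z - 1)| - `|sq psi (- N%:Z - 1)|).
  rewrite -e opprB addrC subrK; exact: eq_psum.
have -> : - N%:Z - 1 = Negz N by lia.
by have := normr_ge0 (sq psi (N%:Z - 1)); have := normr_ge0 (sq psi N); lra.
Qed.

Hypothesis a_lt1 : forall n, `|a n| < 1.

Lemma a_sqr_lt1 n : a n ^+ 2 < 1.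
Proof. by rewrite -real_normK ?num_real// -[ltRHS](expr1n _ 2) ltr_pXn2r ?nnegrE. Qed.

Lemma rr_gt0 n : 0 < rr a n.
Proof. by rewrite sqrtr_gt0 subr_gt0 a_sqr_lt1. Qed.

Lemma rr_sqr n : rr a n ^+ 2 = 1 - a n ^+ 2.
Proof. by rewrite sqr_sqrtr// subr_ge0 ltW// a_sqr_lt1. Qed.

Lemma rr_le1 n : rr a n <= 1.
Proof.
have h := rr_sqr n; have := sqr_ge0 (a n); have := rr_gt0 n.
rewrite expr2 in h; nra.
Qed.

Lemma refl_invol psi : refl start a (refl start a psi) = psi.
Proof.
apply/funext => n; rewrite /refl alt parity_like_pred// subrK addrK.
have e m : (rr a m)%:C * (rr a m)%:C = 1 - (a m)%:C * (a m)%:C.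
  by have := rr_sqr m; rewrite !expr2 => h; apply: complexP => /=; lra.
case: (start n) => /=.
  transitivity (((rr a n)%:C * (rr a n)%:C + (a n)%:C * (a n)%:C) * psi n); first by ring.
  by rewrite e; ring.
transitivity (((rr a (n - 1))%:C * (rr a (n - 1))%:C + (a (n - 1))%:C * (a (n - 1))%:C) * psi n); first by ring.
by rewrite e; ring.
Qed.

Lemma sqm_refl_le psi n : sqm (refl start a psi n) <=
  2 * sqm (psi n) + (2 * sqm (psi (n + 1)) + 2 * sqm (psi (n - 1))).
Proof.
have hc m : sqm ((a m)%:C) <= 1 by rewrite sqm_real ltW// a_sqr_lt1.
have hr m : sqm ((rr a m)%:C) <= 1.
  by rewrite sqm_real rr_sqr; have := sqr_ge0 (a m); lra.
have := sqm_ge0 (psi n); have := sqm_ge0 (psi (n + 1)); have := sqm_ge0 (psi (n - 1)).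
rewrite /refl; case: (start n) => h1 h2 h3; apply: le_trans (sqmD_le _ _) _.
  rewrite !sqmM; have := hc n; have := hr n.
  have := sqm_ge0 (a n)%:C; have := sqm_ge0 (rr a n)%:C; nra.
rewrite sqmN !sqmM; have := hc (n - 1); have := hr (n - 1).
have := sqm_ge0 (a (n - 1))%:C; have := sqm_ge0 (rr a (n - 1))%:C; nra.
Qed.

Lemma l2_refl psi : l2 psi -> l2 (refl start a psi).
Proof.
move=> h; apply: summ_le (summD (summZ 2 h)
  (summD (summZ 2 (l2_shift h)) (summZ 2 (l2_shiftN h)))) => n.
by rewrite ger0_norm ?sq_ge0//; apply: sqm_refl_le.
Qed.

Lemma dot_refl phi psi : l2 phi -> l2 psi ->
  l2dot phi (refl start a psi) = l2dot (refl start a phi) psi.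
Proof.
move=> h1 h2.
have h1' := l2_shift h1; have h2' := l2_shift h2.
pose g n := if start n then rr a n else 0.
have hg n : `|g n| <= 1.
  by rewrite /g; case: (start n); rewrite ?normr0// ger0_norm ?rr_le1// ltW// rr_gt0.
have e n : flux phi psi n = (g n)%:C * (conjc (phi n) * psi (n + 1) - conjc (phi (n + 1)) * psi n).
  by rewrite /flux /g; case: (start n); rewrite ?mul0r.
apply: (@dot_adjoint _ _ _ _ _ (flux phi psi)) => //; try exact: l2_refl.
- apply: summ_le (summ_norm (summB (summ_Re h1 h2') (summ_Re h1' h2))) => n.
  rewrite e; set X := conjc (phi n) * _; set Y := conjc (phi _) * _.
  have -> : complex.Re ((g n)%:C * (X - Y)) = g n * (complex.Re X - complex.Re Y).
    by case: X Y => x x' [y y'] /=; ring.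
  by rewrite normrM ler_piMl.
- apply: summ_le (summ_norm (summB (summ_Im h1 h2') (summ_Im h1' h2))) => n.
  rewrite e; set X := conjc (phi n) * _; set Y := conjc (phi _) * _.
  have -> : complex.Im ((g n)%:C * (X - Y)) = g n * (complex.Im X - complex.Im Y).
    by case: X Y => x x' [y y'] /=; ring.
  by rewrite normrM ler_piMl.
- exact: refl_flux.
Qed.

End Alternating.
End Reflections.

(** * Weak compactness of the unit ball *)

Section WeakCompactness.
Context {R : realType}.
Local Notation C := R[i].
Local Notation vect := (int -> C).
Implicit Types (phi psi x y : vect).

Definition in_window N (n : int) : bool :=
  match n with Posz k => (k < N)%N | Negz k => (k < N)%N end.

Definition trunc N psi : vect := fun n => if in_window N n then psi n else 0.

Lemma psum_window (W : zmodType) (u : int -> W) N M : (N <= M)%N ->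
  psum (fun n => if in_window N n then u n else 0) M = psum u N.
Proof.
move=> h; rewrite /psum (big_cat_nat (n := N))//= -[RHS]addr0; congr (_ + _).
  by apply: eq_big_nat => k /andP[_ ->].
by rewrite big_nat big1// => k /andP[h1 _]; rewrite ltnNge h1 addr0.
Qed.

Lemma sumZ_window (u : int -> R) N :
  sumZ (fun n => if in_window N n then u n else 0) = psum u N.
Proof.
apply: sumZ_lim; rewrite -(cvg_shiftn N) [X in X @ _](_ : _ = fun=> psum u N); first exact: cvg_cst.
by apply/funext => M /=; rewrite psum_window ?leq_addl.
Qed.

Lemma sq_trunc N psi n : sq (trunc N psi) n = if in_window N n then sq psi n else 0.
Proof. by rewrite /sq /trunc; case: ifP => // _; rewrite sqm0. Qed.

Lemma l2_trunc N psi : l2 (trunc N psi).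
Proof.
apply: (@l2_psum _ _ (psum (sq psi) N)) => M.
rewrite -(@psum_window _ _ N (maxn N M)) ?leq_maxl//.
rewrite -(eq_psum _ (sq_trunc N psi)); apply: psum_nd; last exact: leq_maxr.
exact: sq_ge0.
Qed.

Lemma nsq_trunc N psi : nsq (trunc N psi) = psum (sq psi) N.
Proof. by rewrite /nsq (eq_sumZ (sq_trunc N psi)) sumZ_window. Qed.

Lemma nsq_trunc_compl N psi : l2 psi -> nsq (psi - trunc N psi) = nsq psi - psum (sq psi) N.
Proof.
move=> h; rewrite -nsq_trunc -sumZB//; last exact: l2_trunc.
apply: eq_sumZ => n; rewrite sq_trunc /sq !fctE /trunc.
by case: ifP => _; rewrite ?(subrr, sqm0, subr0).
Qed.

Lemma nsq_trunc_small psi e : l2 psi -> 0 < e -> exists N, nsq (psi - trunc N psi) < e.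
Proof.
move=> h e0; have [N hN] := sumZ_tail (sq_ge0 psi) h e0.
by exists N; rewrite nsq_trunc_compl// hN.
Qed.

Lemma dot_trunc N phi psi : l2 phi -> l2 psi ->
  l2dot (trunc N phi) psi = l2dot phi (trunc N psi).
Proof.
move=> h1 h2; apply: complexP => /=; apply: eq_sumZ => n; rewrite /trunc;
  by case: ifP => _ //; rewrite ?conjc0 ?mul0r ?mulr0.
Qed.

(** The discriminant argument along the line of [psi - t d phi], [d] being the inner product. *)
Lemma cauchy_schwarz phi psi : l2 phi -> l2 psi ->
  sqm (l2dot phi psi) <= nsq phi * nsq psi.
Proof.
move=> h1 h2; set d := l2dot phi psi; set p := nsq phi; set q := nsq psi.
have hp : 0 <= p by exact: nsq_ge0.
have hq : 0 <= q by exact: nsq_ge0.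
have key (t : R) : 0 <= p * (t ^+ 2 * sqm d) + q - 2 * t * sqm d.
  have hz : l2 (scal (- (t%:C * d)) phi) by exact: l2Z.
  have := nsq_ge0 (l2D hz h2); rewrite nsqD// nsqZ// dotZl//.
  rewrite -/d -/p -/q sqmN sqmM sqm_real.
  have -> : complex.Re (conjc (- (t%:C * d)) * d) = - (t * sqm d).
    by rewrite conjN conjM conjc_real mulNr -mulrA conj_mul -rmorphM /= .
  by lra.
have hd := sqm_ge0 d.
case: (eqVneq p 0) => [p0|p0].
  rewrite p0 mul0r; case: (ltrP 0 (sqm d)) => // d1.
  have := key ((q + 1) / (2 * sqm d)); rewrite p0 !mul0r add0r.
  have -> : 2 * ((q + 1) / (2 * sqm d)) * sqm d = q + 1 by field; rewrite gt_eqF.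
  by lra.
have p1 : 0 < p by rewrite lt_def p0.
have := key (p^-1).
have -> : p * (p^-1 ^+ 2 * sqm d) + q - 2 * p^-1 * sqm d = (p * q - sqm d) / p by field.
by rewrite pmulr_lge0 ?invr_gt0// subr_ge0.
Qed.

(** A triangle inequality for squares in which the constant of [phi] can be
    brought as close to [1] as desired. *)
Lemma nsqD_le_eta phi psi (s t : R) : l2 phi -> l2 psi -> 0 < s -> 0 < t -> s * t = 1 ->
  nsq (phi + psi) <= (1 + s) * nsq phi + (1 + t) * nsq psi.
Proof.
move=> h1 h2 s0 t0 st; rewrite -!sumZZ// -sumZD; try exact: summZ.
apply: le_sumZ; [exact: l2D|by apply: summD; apply: summZ|].
move=> n; rewrite /sq fctE; case: (phi n) (psi n) => a b [c d]; rewrite /sqm /=.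
have h := mulr_ge0 (ltW t0) (addr_ge0 (sqr_ge0 (s * a - c)) (sqr_ge0 (s * b - d))).
have e : t * ((s * a - c) ^+ 2 + (s * b - d) ^+ 2) =
  s * (s * t) * (a ^+ 2 + b ^+ 2) - 2 * (s * t) * (a * c + b * d) + t * (c ^+ 2 + d ^+ 2) by ring.
rewrite e st in h.
have -> : (a + c) ^+ 2 + (b + d) ^+ 2 = (a ^+ 2 + b ^+ 2) + 2 * (a * c + b * d) + (c ^+ 2 + d ^+ 2) by ring.
lra.
Qed.

(** The form in which compactness is used: where the weight is not small, only
    finitely many values of [u] count. *)
Lemma sumZ_weight_le (c u : int -> R) B eta N :
  (forall n, 0 <= c n <= B) -> (forall n, ~~ in_window N n -> c n <= eta) ->
  (forall n, 0 <= u n) -> summ u -> 0 <= eta ->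
  sumZ (fun n => c n * u n) <= B * psum u N + eta * sumZ u.
Proof.
move=> hc hN hu su eta0.
have hs : summ (fun n => c n * u n).
  apply: summ_le (summZ B su) => n; have /andP[c0 c1] := hc n.
  by rewrite ger0_norm ?mulr_ge0// ler_wpM2r.
rewrite -(sumZ_window u N) -!sumZZ//; last first.
  by apply: summ_le su => n; case: ifP => _; rewrite ?normr0// ger0_norm.
have hw : summ (fun n => if in_window N n then u n else 0).
  by apply: summ_le su => n; case: ifP => _; rewrite ?normr0// ger0_norm.
rewrite -sumZD; try exact: summZ.
apply: le_sumZ => // [|n]; first by apply: summD; apply: summZ.
have /andP[c0 c1] := hc n; have := hu n; case: ifPn => [_|/hN]; nra.
Qed.

Lemma bounded_ultralim (G : set_system nat) (u : nat -> R) B : UltraFilter G ->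
  (forall k, `|u k| <= B) -> exists l : R, u @ G --> l.
Proof.
move=> hG hu; have hP : ProperFilter (u @ G) by exact: fmap_proper_filter.
have hB : (u @ G) `[(- B), B]%classic.
  by apply: (@filterE _ G) => k /=; rewrite in_itv /= -ler_norml.
have [l [_ hl]] := @segment_compact R (- B) B _ hP hB.
exists l => A hA; have [//|hn] := in_ultra_setVsetC (u @^-1` A) hG.
have [z [zA Az]] := hl (~` A) A hn hA.
by case: zA.
Qed.

Lemma cvg_psum (G : set_system nat) (u : nat -> int -> R) (v : int -> R) N : Filter G ->
  (forall n, u k n @[k --> G] --> v n) -> psum (u k) N @[k --> G] --> psum v N.
Proof.
move=> hG h; elim: N => [|N ih].
  rewrite psum0 [X in X @ _](_ : _ = fun=> 0); first exact: cvg_cst.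
  by apply/funext => k; rewrite psum0.
rewrite psumS [X in X @ _](_ : _ = fun k => psum (u k) N + (u k N + u k (Negz N))).
  by apply: cvgD => //; apply: cvgD.
by apply/funext => k; rewrite psumS.
Qed.

(** Coordinates are bounded, so they converge along an ultrafilter, and no
    subsequence has to be extracted. The limit stays in the ball because every
    partial sum of squares passes to the limit. *)
Lemma weak_limit (G : set_system nat) (x : nat -> vect) : UltraFilter G ->
  (forall k, l2 (x k)) -> (forall k, nsq (x k) <= 1) ->
  exists y, [/\ l2 y, nsq y <= 1 &
    forall N e, 0 < e -> G [set k | psum (sq (x k - y)) N < e]].
Proof.
move=> hG hx hx1; have hP : ProperFilter G by exact: ultra_proper.
have hb k n : sq (x k) n <= 1 by apply: le_trans (sq_le_nsq n (hx k)) (hx1 k).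
have hre n : exists l : R, complex.Re (x k n) @[k --> G] --> l.
  apply: (@bounded_ultralim _ _ 1) => k; have := hb k n; rewrite /sq /sqm => h.
  rewrite -(@ler_pXn2r _ 2) ?nnegrE// expr1n real_normK ?num_real//.
  by have := sqr_ge0 (complex.Im (x k n)); lra.
have him n : exists l : R, complex.Im (x k n) @[k --> G] --> l.
  apply: (@bounded_ultralim _ _ 1) => k; have := hb k n; rewrite /sq /sqm => h.
  rewrite -(@ler_pXn2r _ 2) ?nnegrE// expr1n real_normK ?num_real//.
  by have := sqr_ge0 (complex.Re (x k n)); lra.
have [yr hyr] := choice hre; have [yi hyi] := choice him.
pose y : vect := fun n => yr n +i* yi n.
have hsq n : sq (x k) n @[k --> G] --> sq y n.
  by rewrite /sq /sqm /=; apply: cvgD; under eq_fun do rewrite expr2; rewrite expr2; apply: cvgM.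
have hdif n : sq (x k - y) n @[k --> G] --> 0.
  have -> : 0 = (yr n - yr n) * (yr n - yr n) + (yi n - yi n) * (yi n - yi n) :> R.
    by rewrite !subrr mulr0 addr0.
  rewrite [X in X @ _](_ : _ = fun k => (complex.Re (x k n) - yr n) * (complex.Re (x k n) - yr n) +
    (complex.Im (x k n) - yi n) * (complex.Im (x k n) - yi n)); last first.
    by apply/funext => k; rewrite /sq fctE /sqm /y; case: (x k n) => a b /=; rewrite !expr2.
  by apply: cvgD; apply: cvgM; apply: cvgB => //; apply: cvg_cst.
have hy1 N : psum (sq y) N <= 1.
  have hF : Filter G by exact: filter_filter.
have c := @cvg_psum G (fun k => sq (x k)) _ N hF hsq.
  rewrite -(cvg_lim _ c)//; apply: limr_le; first by apply/cvg_ex; exists (psum (sq y) N).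
  by apply: filterE => k; apply: le_trans (psum_le_nsq N (hx k)) (hx1 k).
have hy := l2_psum hy1.
exists y; split => //; first exact: nsq_le.
move=> N e e0; have hF : Filter G by exact: filter_filter.
have c := @cvg_psum G (fun k => sq (x k - y)) (fun=> 0) N hF hdif.
have z0 : psum (fun _ : int => 0 : R) N = 0 by rewrite /psum big1// => k _; rewrite addr0.
rewrite z0 in c; apply: (filterS _ ((cvgrPdist_lt _ _).1 c e e0)) => k.
by rewrite sub0r normrN /= ger0_norm// psum_ge0//; apply: sq_ge0.
Qed.

(** [phi] is small outside a window, and [x k - y] is small inside it. *)
Lemma weak_limit_orthogonal (G : set_system nat) (x : nat -> vect) y phi : ProperFilter G ->
  l2 phi -> l2 y -> nsq y <= 1 ->
  (forall k, l2 (x k)) -> (forall k, nsq (x k) <= 1) ->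
  (forall N e, 0 < e -> G [set k | psum (sq (x k - y)) N < e]) ->
  (forall k, l2dot phi (x k) = 0) -> l2dot phi y = 0.
Proof.
move=> hG hphi hy hy1 hx hx1 hlim h0.
apply: sqm_eq0; apply/eqP; rewrite eq_le sqm_ge0 andbT.
apply/ler_addgt0Pl => e e0; rewrite addr0.
have [N hN] := nsq_trunc_small hphi (divr_gt0 e0 (ltr0n _ 16)).
have p0 : 0 <= nsq phi by exact: nsq_ge0.
have p1 : 0 < nsq phi + 1 by lra.
have e1 : 0 < e / (4 * (nsq phi + 1)) by rewrite divr_gt0// mulr_gt0.
have [k /= hk] := filter_ex (hlim N _ e1).
set d := x k - y in hk; have hd : l2 d by exact: l2B.
have nd : nsq d <= 4.
  apply: le_trans (nsqD_le (hx k) (l2N hy)) _; rewrite nsqN; have := hx1 k; lra.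
have ht : l2 (trunc N phi) by exact: l2_trunc.
have htc : l2 (phi - trunc N phi) by exact: l2B.
have -> : sqm (l2dot phi y) = sqm (l2dot phi d).
  by rewrite /d dotBr// h0 sub0r sqmN.
have -> : l2dot phi d = l2dot phi (trunc N d) + l2dot (phi - trunc N phi) d.
  by rewrite -dot_trunc// -dotDl// addrC subrK.
apply: le_trans (sqmD_le _ _) _.
have b1 := cauchy_schwarz hphi (l2_trunc N d); rewrite nsq_trunc in b1.
have b2 := cauchy_schwarz htc hd.
have q0 := nsq_ge0 htc; have q1 := psum_ge0 N (sq_ge0 d).
have b3 : nsq phi * psum (sq d) N <= e / 4.
  apply: le_trans (_ : (nsq phi + 1) * (e / (4 * (nsq phi + 1))) <= _); last first.
    by rewrite le_eqVlt; apply/orP; left; apply/eqP; field; lra.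
  by apply: ler_pM => //; [lra|exact: ltW].
have b4 : nsq (phi - trunc N phi) * nsq d <= e / 16 * 4.
  by apply: ler_pM => //; [exact: nsq_ge0|exact: ltW].
lra.
Qed.

End WeakCompactness.

(** * Diagonalization of compact perturbations of -1 *)

Section CompactPerturbationOfMinusOne.
Context {R : realType}.
Local Notation C := R[i].
Local Notation vect := (int -> C).
Implicit Types (phi psi x y w : vect) (z : C) (l : seq vect).

Variables (U V : vect -> vect) (c : int -> R) (B : R).
Hypothesis UD : forall x y, U (x + y) = U x + U y.
Hypothesis UZ : forall z x, U (scal z x) = scal z (U x).
Hypothesis VD : forall x y, V (x + y) = V x + V y.
Hypothesis VZ : forall z x, V (scal z x) = scal z (V x).
Hypothesis UV : forall x, U (V x) = x.
Hypothesis VU : forall x, V (U x) = x.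
Hypothesis l2U : forall x, l2 x -> l2 (U x).
Hypothesis l2V : forall x, l2 x -> l2 (V x).
Hypothesis dotU : forall x y, l2 x -> l2 y -> l2dot x (U y) = l2dot (V x) y.

Let K x := U x + x.

Hypothesis c_bound : forall n, 0 <= c n <= B.
Hypothesis c_vanish : forall e, 0 < e -> exists N, forall n, ~~ in_window N n -> c n <= e.
Hypothesis K_bound : forall x, l2 x -> nsq (K x) <= sumZ (fun n => c n * sq x n).
Hypothesis K_dense : forall psi e, l2 psi -> 0 < e ->
  exists x, l2 x /\ nsq (psi - K x) < e.

Let UN x : U (- x) = - U x.
Proof. by rewrite !scalN1 UZ. Qed.

Let VN x : V (- x) = - V x.
Proof. by rewrite !scalN1 VZ. Qed.

Let dotV x y : l2 x -> l2 y -> l2dot x (V y) = l2dot (U x) y.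
Proof.
move=> h1 h2; rewrite dotC//; last exact: l2V.
by rewrite -dotU// -dotC//; apply: l2U.
Qed.

Let nsqU x : l2 x -> nsq (U x) = nsq x.
Proof.
move=> h; have := dot_self (l2U h); rewrite dotU//; last exact: l2U.
by rewrite VU dot_self// => -[].
Qed.

Let l2K x : l2 x -> l2 (K x).
Proof. by move=> h; apply: l2D => //; apply: l2U. Qed.

Let nsqK_le x : l2 x -> nsq (K x) <= 4 * nsq x.
Proof.
by move=> h; have := nsqD_le (l2U h) h; rewrite nsqU// -/(K x); lra.
Qed.

Let KD x y : K (x + y) = K x + K y.
Proof. by rewrite /K UD addrACA. Qed.

Let KZ z x : K (scal z x) = scal z (K x).
Proof. by rewrite /K UZ scalD. Qed.

Let KN x : K (- x) = - K x.
Proof. by rewrite !scalN1 KZ. Qed.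

Let dotK x y : l2 x -> l2 y -> l2dot x (K y) = l2dot (V x + x) y.
Proof.
move=> h1 h2; rewrite /K dotDr//; last exact: l2U.
by rewrite dotU// dotDl//; apply: l2V.
Qed.

(** [U x = - x] implies [V x = - x], so [x] is orthogonal to the range of [K], which is dense. *)
Let K_injective x : l2 x -> nsq (K x) = 0 -> x = 0.
Proof.
move=> h /nsq_eq0 => /(_ (l2K h)) kx.
have ux : U x = - x by apply/eqP; rewrite -addr_eq0; apply/eqP.
have vx : V x = - x by rewrite -[in LHS](opprK x) -ux VN VU.
apply: nsq_eq0 => //; apply/eqP; apply/negPn/negP => n0.
have n1 : 0 < nsq x by rewrite lt_def n0 nsq_ge0.
have [w [hw]] := K_dense h n1.
have hK := l2N (l2K hw); have := nsq_ge0 hK.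
rewrite nsqD// dotNr//; last exact: l2K.
by rewrite dotK// vx addNr dot0l//= oppr0 mulr0 addr0; lra.
Qed.

(** Vectors that are small on a window are almost killed by [K]. *)
Let psum_decay e : 0 < e -> exists N, forall x, l2 x -> nsq x <= 4 ->
  nsq (K x) <= B * psum (sq x) N + e.
Proof.
move=> e0; have e1 : 0 < e / 4 by rewrite divr_gt0.
have [N hN] := c_vanish e1; exists N => x h hx.
apply: le_trans (K_bound h) _.
apply: le_trans (sumZ_weight_le c_bound hN (sq_ge0 x) h (ltW e1)) _.
by rewrite lerD2l -/(nsq x); nra.
Qed.

Definition orth l x := l2 x /\ forall j, (j < size l)%N -> l2dot (nth 0 l j) x = 0.

Let orthD l x y : (forall j, (j < size l)%N -> l2 (nth 0 l j)) ->
  orth l x -> orth l y -> orth l (x + y).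
Proof.
move=> hl [h1 e1] [h2 e2]; split; first exact: l2D.
by move=> j hj; rewrite dotDr ?e1 ?e2 ?addr0//; apply: hl.
Qed.

Let orthZ l z x : (forall j, (j < size l)%N -> l2 (nth 0 l j)) ->
  orth l x -> orth l (scal z x).
Proof.
move=> hl [h1 e1]; split; first exact: l2Z.
by move=> j hj; rewrite dotZr ?e1 ?mulr0//; apply: hl.
Qed.

(** Weak compactness of the ball and complete continuity of [K] make the
    supremum of [nsq \o K] on the ball of an orthogonal complement a maximum. *)
Let maximizer l : (forall j, (j < size l)%N -> l2 (nth 0 l j)) ->
  exists y, [/\ orth l y, nsq y <= 1 &
    forall x, orth l x -> nsq x <= 1 -> nsq (K x) <= nsq (K y)].
Proof.
move=> hl.
pose A := [set r : R | exists x, [/\ orth l x, nsq x <= 1 & r = nsq (K x)]].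
have A0 : A 0.
  have o0 : orth l 0 by split; [exact: l20|move=> j hj; rewrite dot0r//; apply: hl].
  have k0 : K 0 = 0.
    have := KD 0 0; rewrite addr0 => /eqP; rewrite -subr_eq0 opprD addrA subrr sub0r oppr_eq0.
    by move/eqP.
  have n0 : nsq (0 : vect) = 0.
    by have := nsqZ 0 (l20 (R := R)); rewrite sqm0 mul0r => <-; congr nsq; apply/funext => n; rewrite /scal mul0r.
  by exists 0; rewrite k0 n0.
have Aub r : A r -> r <= 4.
  by move=> [x [[hx _] nx ->]]; have := nsqK_le hx; lra.
have hsup : has_sup A by split; [exists 0|exists 4 => r; exact: Aub].
pose S := sup A.
have hS x : orth l x -> nsq x <= 1 -> nsq (K x) <= S.
  by move=> ox nx; apply: sup_upper_bound => //; exists x.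
have ex k : exists x, [/\ orth l x, nsq x <= 1 & S - k.+1%:R^-1 < nsq (K x)].
  have k0 : 0 < (k.+1%:R^-1 : R) by rewrite invr_gt0 ltr0n.
  have [r [x [ox nx ->]] hr] := sup_adherent k0 hsup.
  by exists x.
have [xs hxs] := choice ex.
have xl2 k : l2 (xs k) by have [[]] := hxs k.
have xn k : nsq (xs k) <= 1 by have [] := hxs k.
have [G [hG hsub]] := ultraFilterLemma (F := \oo).
have hP : ProperFilter G by exact: ultra_proper.
have [y [hy ny hlim]] := weak_limit hG xl2 xn.
have oy : orth l y.
  split=> // j hj; apply: (@weak_limit_orthogonal _ G xs) => //; first exact: hl.
  by move=> k; have [[_ h] _ _] := hxs k; apply: h.
exists y; split=> // x ox nx; apply: le_trans (hS x ox nx) _.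
apply/ler_addgt0Pl => e e0.
(* [(1 + s) nsq (K y)] exceeds [nsq (K y)] by [e / 4] at most, and [d] is such
   that [(1 + t) d = e / 4]. *)
pose s := e / 16; pose t := 16 / e; pose d := e / (4 * (1 + t)).
have s0 : 0 < s by rewrite divr_gt0.
have t0 : 0 < t by rewrite divr_gt0.
have st : s * t = 1 by rewrite /s /t; field; rewrite gt_eqF.
have d0 : 0 < d by rewrite divr_gt0// mulr_gt0//; lra.
have d2 : 0 < d / 2 by rewrite divr_gt0.
have [N hN] := psum_decay d2.
have B0 : 0 <= B by have /andP[] := c_bound 0; exact: le_trans.
have g0 : 0 < d / 2 / (B + 1) by rewrite divr_gt0//; lra.
have [m hm] : exists m : nat, (m.+1%:R^-1 : R) < e / 4.
  have e4 : 0 < 4 / e by rewrite divr_gt0.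
  have := archi_boundP (ltW e4); set m := Num.bound _ => hm.
  exists m; rewrite -[ltRHS]invrK ltf_pV2 ?posrE ?invr_gt0 ?divr_gt0//.
  by rewrite invf_div; apply: lt_le_trans hm _; rewrite ler_nat.
have [k [/= hk1 hk2]] : exists k, psum (sq (xs k - y)) N < d / 2 / (B + 1) /\ (m <= k)%N.
  have G1 := hlim N _ g0.
  have G2 : G [set k | (m <= k)%N] by apply: hsub; exists m.
  by have [k [h1 h2]] := filter_ex (filterI G1 G2); exists k.
have dl2 : l2 (xs k - y) by exact: l2B.
have dn : nsq (xs k - y) <= 4.
  by apply: le_trans (nsqD_le (xl2 k) (l2N hy)) _; rewrite nsqN; have := xn k; lra.
have Kd : nsq (K (xs k - y)) <= d.
  apply: le_trans (hN _ dl2 dn) _.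
  have : B * psum (sq (xs k - y)) N <= (B + 1) * (d / 2 / (B + 1)).
    apply: ler_pM => //; [by apply: psum_ge0; exact: sq_ge0|lra|exact: ltW].
  have -> : (B + 1) * (d / 2 / (B + 1)) = d / 2 by field; lra.
  by lra.
have Kx : nsq (K (xs k)) <= (1 + s) * nsq (K y) + (1 + t) * d.
  have {1}-> : xs k = y + (xs k - y) by rewrite addrC subrK.
  rewrite KD; apply: le_trans (nsqD_le_eta (l2K hy) (l2K dl2) s0 t0 st) _.
  by rewrite lerD2l ler_wpM2l//; lra.
have e1 : (1 + t) * d = e / 4 by rewrite /d; field; lra.
have [_ _ hSk] := hxs k.
have k1 : (k.+1%:R^-1 : R) <= m.+1%:R^-1 by rewrite lef_pV2 ?posrE ?ltr0n// ler_nat.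
have Ky4 : nsq (K y) <= 4 by have := nsqK_le hy; lra.
have sK : s * nsq (K y) <= e / 4 by rewrite /s; nra.
have eK : (1 + s) * nsq (K y) = nsq (K y) + s * nsq (K y) by ring.
rewrite e1 eK in Kx.
move: hSk k1 hm sK Kx; set ki : R := k.+1%:R^-1; set mi : R := m.+1%:R^-1.
set a := nsq (K y); set b := nsq (K (xs k)); set sa := s * a => h1 h2 h3 h4 h5.
by apply: le_trans (_ : b + ki <= _); lra.
Qed.

(** The hypothesis says that [(U - z) (U - conjc z)] kills [x]. This provides the
    eigenvectors of both the compact part and the transport part. *)
Lemma quadratic_eigenvector x z : U x + V x = scal (z + conjc z) x -> sqm z = 1 ->
  U (U x - scal (conjc z) x) = scal z (U x - scal (conjc z) x).
Proof.
move=> e hz.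
have hzz : z * conjc z = 1 by rewrite mulrC conj_mul hz.
have := congr1 U e; rewrite UD UV UZ => e2.
have -> : U (U x - scal (conjc z) x) = U (U x) - scal (conjc z) (U x).
  by rewrite UD UN UZ.
have -> : U (U x) = scal (z + conjc z) (U x) - x by rewrite -e2 addrK.
apply/funext => n; rewrite /scal !fctE.
rewrite mulrBr mulrA hzz; ring.
Qed.

Definition eigen_orthonormal l :=
  [/\ forall j, (j < size l)%N -> l2 (nth 0 l j),
      forall j, (j < size l)%N -> exists z, U (nth 0 l j) = scal z (nth 0 l j) &
      forall j k, (j < size l)%N -> (k < size l)%N ->
        l2dot (nth 0 l j) (nth 0 l k) = (j == k)%:R].

Let eigenvalue_sqm x z : l2 x -> nsq x = 1 -> U x = scal z x -> sqm z = 1.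
Proof. by move=> h e h1; have := nsqU h; rewrite h1 nsqZ// e mulr1. Qed.

Let eigenV x z : sqm z = 1 -> U x = scal z x -> V x = scal (conjc z) x.
Proof.
move=> hz h; rewrite -[in RHS](VU x) h VZ scalA conj_mul hz.
by rewrite -[X in X = _]scal1.
Qed.

Let nsq_unit l j : eigen_orthonormal l -> (j < size l)%N -> nsq (nth 0 l j) = 1.
Proof.
by move=> [h1 _ h2] hj; have := h2 j j hj hj; rewrite eqxx dot_self; [case|exact: h1].
Qed.

Let orthU l x : eigen_orthonormal l -> orth l x -> orth l (U x).
Proof.
move=> hl [h0 e0]; split; first exact: l2U.
move=> j hj; have [h1 h2 _] := hl; have [z hz] := h2 j hj.
rewrite dotU//; last exact: h1.
have hz1 := eigenvalue_sqm (h1 j hj) (nsq_unit hl hj) hz.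
by rewrite (eigenV hz1 hz) dotZl ?e0 ?mulr0//; apply: h1.
Qed.

Let orthV l x : eigen_orthonormal l -> orth l x -> orth l (V x).
Proof.
move=> hl [h0 e0]; split; first exact: l2V.
move=> j hj; have [h1 h2 _] := hl; have [z hz] := h2 j hj.
by rewrite dotV ?hz ?dotZl ?e0 ?mulr0//; apply: h1.
Qed.

Definition resid l psi : vect :=
  psi - \sum_(j < size l) scal (l2dot (nth 0 l j) psi) (nth 0 l j).

Let l2_proj l psi : eigen_orthonormal l ->
  l2 (\sum_(j < size l) scal (l2dot (nth 0 l j) psi) (nth 0 l j)).
Proof. by move=> [h1 _ _]; apply: l2_sum => j _; apply: l2Z; apply: h1. Qed.

Let resid_orth l psi : eigen_orthonormal l -> l2 psi -> orth l (resid l psi).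
Proof.
move=> hl hpsi; have [h1 _ h3] := hl.
split; first by apply: l2B => //; exact: l2_proj.
move=> j hj; rewrite /resid dotBr//; [|exact: h1|exact: l2_proj].
rewrite dot_sumr; [|exact: h1|by move=> i _; apply: l2Z; apply: h1].
rewrite (bigD1 (Ordinal hj))//= dotZr; [|exact: h1|exact: h1].
rewrite h3// eqxx mulr1 big1 ?addr0 ?subrr// => i hi.
rewrite dotZr; [|exact: h1|exact: h1].
rewrite h3// (_ : (j == i) = false) ?mulr0//.
by apply/negbTE; apply: contra hi => /eqP e; apply/eqP/val_inj.
Qed.

Let nsq_resid l psi : eigen_orthonormal l -> l2 psi ->
  nsq psi = nsq (resid l psi) + \sum_(j < size l) sqm (l2dot (nth 0 l j) psi).
Proof.
move=> hl hpsi; have [h1 _ h3] := hl.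
have [hr er] := resid_orth hl hpsi.
pose p := \sum_(j < size l) scal (l2dot (nth 0 l j) psi) (nth 0 l j).
have hp : l2 p by exact: l2_proj.
have d0 : l2dot (resid l psi) p = 0.
  rewrite dot_sumr//; last by move=> i _; apply: l2Z; apply: h1.
  apply: big1 => i _; rewrite dotZr//; last exact: h1.
  by rewrite [l2dot (resid l psi) _]dotC//; [rewrite er// conjc0 mulr0|exact: h1].
have np : nsq p = \sum_(j < size l) sqm (l2dot (nth 0 l j) psi).
  have := dot_self hp; rewrite {2}/p dot_sumr//; last by move=> i _; apply: l2Z; apply: h1.
  have -> : \sum_(i < size l) l2dot p (scal (l2dot (nth 0 l i) psi) (nth 0 l i)) =
      (\sum_(j < size l) sqm (l2dot (nth 0 l j) psi))%:C.
    rewrite rmorph_sum /=; apply: eq_bigr => i _.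
    rewrite dotZr//; last exact: h1.
    rewrite [l2dot p _]dotC//; last exact: h1.
    have -> : l2dot (nth 0 l i) p = l2dot (nth 0 l i) psi.
      have := er i (ltn_ord i); rewrite /resid dotBr//; last exact: h1.
      by move/eqP; rewrite subr_eq0 => /eqP.
    by rewrite mulrC conj_mul.
  by case.
have e : psi = resid l psi + p by rewrite /resid subrK.
by rewrite {1}e nsqD// d0 mulr0 addr0 np.
Qed.

Let resid_nonzero l : eigen_orthonormal l -> exists x, orth l x /\ 0 < nsq x.
Proof.
move=> hl; have [h1 _ _] := hl.
apply: contrapT => hn.
have h0 n : \sum_(j < size l) sq (nth 0 l j) n = 1.
  have hd := l2_delta (R := R) n.
  have := nsq_resid hl hd; rewrite nsq_delta.
  have -> : nsq (resid l (delta R n)) = 0.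
    have ho := resid_orth hl hd; apply/eqP/negPn/negP => n0; apply: hn.
    by exists (resid l (delta R n)); split=> //; rewrite lt_def n0 nsq_ge0//; case: ho.
  rewrite add0r => ->; apply: eq_bigr => j _.
  rewrite dotC//; last exact: h1.
  by rewrite dot_delta sqm_conj.
pose N := (size l).+1.
have e1 : psum (fun _ : int => 1 : R) N <= (size l)%:R.
  rewrite -(eq_psum _ h0) psum_sum.
  apply: le_trans (_ : \sum_(j < size l) (1 : R) <= _).
    apply: ler_sum => j _; rewrite -(nsq_unit hl (ltn_ord j)).
    by apply: psum_le_nsq; apply: h1.
  by rewrite sumr_const card_ord.
have e2 : psum (fun _ : int => 1 : R) N = N%:R * 2.
  by rewrite /psum sumr_const_nat subn0 mulr_natl.
by move: e1; rewrite e2 /N -natr1; have := ler0n R (size l); lra.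
Qed.

(** One step of the greedy choice. A maximizer [y] of the norm of [K] satisfies
    [K^* K y = s2 y], that is [U y + V y = (s2 - 2) y], which factors as in
    [quadratic_eigenvector]. Either factor may already kill [y]. *)
Let next_eigenvector l : eigen_orthonormal l -> exists phi, exists z,
  [/\ orth l phi, nsq phi = 1, U phi = scal z phi, 0 < sqm (1 + z) &
    forall x, orth l x -> nsq (K x) <= sqm (1 + z) * nsq x].
Proof.
move=> hl; have [h1 _ _] := hl.
have [y [oy ny hmax]] := maximizer h1.
have hy : l2 y by case: oy.
pose s2 := nsq (K y).
have hs x : orth l x -> nsq (K x) <= s2 * nsq x.
  move=> ox; have hx : l2 x by case: ox.
  case: (eqVneq (nsq x) 0) => [e0|n0].
    by rewrite e0 mulr0; apply: le_trans (nsqK_le hx) _; rewrite e0 mulr0.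
  have p : 0 < nsq x by rewrite lt_def n0 nsq_ge0.
  pose t : R := (Num.sqrt (nsq x))^-1.
  have t2 : t ^+ 2 = (nsq x)^-1 by rewrite /t exprVn sqr_sqrtr// ltW.
  have := hmax _ (orthZ t%:C h1 ox); rewrite KZ !nsqZ//; last exact: l2K.
  rewrite sqm_real t2 mulVf// lexx => /(_ isT).
  by rewrite mulrC ler_pdivrMr.
have [x0 [ox0 x0pos]] := resid_nonzero hl.
have s2pos : 0 < s2.
  have := hs x0 ox0; have hx0 : l2 x0 by case: ox0.
  have : 0 < nsq (K x0).
    rewrite lt_def nsq_ge0 ?andbT; last exact: l2K.
    apply/eqP => /(K_injective hx0) e; move: x0pos.
    have := nsqZ 0 (l20 (R := R)); rewrite sqm0 mul0r.
    have -> : scal 0 (0 : vect) = 0 by apply/funext => n; rewrite /scal mul0r.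
    by rewrite e => ->; rewrite ltxx.
  by move=> p1 p2; nra.
have ny1 : nsq y = 1.
  by apply/eqP; rewrite eq_le ny /=; have := hs y oy; rewrite -/s2; nra.
pose h := V (K y) + K y - scal s2%:C y.
have oK x : orth l x -> orth l (K x) by move=> ox; apply: orthD => //; apply: orthU.
have oh : orth l h.
  rewrite /h scalN1; apply: orthD => //; last by do 2 apply: orthZ => //.
  by apply: orthD => //; [apply: orthV => //; exact: oK|exact: oK].
have hh : l2 h by case: oh.
have hKy := l2K hy; have hVKy := l2V hKy.
(* The first-order condition at the maximum, in the direction [h], with step [1 / s2]. *)
have h_0 : h = 0.
  apply: nsq_eq0 => //; apply/eqP; rewrite eq_le nsq_ge0// andbT.
  have e0 : 0 < s2^-1 by rewrite invr_gt0.
  have := hs _ (orthD h1 oy (orthZ (s2^-1)%:C h1 oh)).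
  have hZ := l2Z (s2^-1)%:C hh.
  rewrite KD KZ nsqD//; [|exact: l2Z (l2K hh)].
  rewrite nsqD// !nsqZ//; last exact: l2K.
  rewrite !dotZr//; last exact: l2K.
  rewrite dotK// sqm_real ny1 -/s2.
  have -> : V (K y) + K y = h + scal s2%:C y by rewrite /h subrK.
  rewrite dotDl//; last exact: l2Z.
  rewrite dotZl// dot_self// conjc_real.
  have := nsq_ge0 (l2K hh).
  set a := nsq h; set b := nsq (K h); set q := l2dot y h => b0.
  have -> : complex.Re ((s2^-1)%:C * (a%:C + s2%:C * q)) = s2^-1 * a + complex.Re q.
    case: q => q1 q2 /=; field; exact: lt0r_neq0.
  have -> : complex.Re ((s2^-1)%:C * q) = s2^-1 * complex.Re q.
    by case: q => q1 q2 /=; ring.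
  have -> : s2 * (1 + s2^-1 ^+ 2 * a + 2 * (s2^-1 * complex.Re q)) =
    s2 + s2^-1 * a + 2 * complex.Re q by field; exact: lt0r_neq0.
  have := mulr_ge0 (sqr_ge0 s2^-1) b0 => b1 b2.
  have : s2^-1 * a <= 0 by lra.
  by rewrite pmulr_rle0.
have s4 : s2 <= 4 by have := nsqK_le hy; rewrite ny1 -/s2; lra.
pose g := s2 / 2 - 1.
have g1 : g ^+ 2 <= 1 by rewrite /g expr2; nra.
pose z : C := g +i* Num.sqrt (1 - g ^+ 2).
have hz : sqm z = 1 by rewrite /sqm /= sqr_sqrtr ?subr_ge0// addrC subrK.
have hz1 : sqm (1 + z) = s2.
  rewrite /sqm /= add0r sqr_sqrtr ?subr_ge0//; rewrite /g; lra.
have hz2 : sqm (1 + conjc z) = s2.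
  by rewrite -hz1 -[in LHS](conjc1 R) -conjD sqm_conj.
have eq2 : U y + V y = scal (z + conjc z) y.
  have : K (V y) + K y = scal s2%:C y.
    apply/eqP; rewrite -subr_eq0; apply/eqP; rewrite -[RHS]h_0 /h; congr (_ + _ - _).
    by rewrite /K UV VD VU addrC.
  rewrite /K UV => e; apply/funext => n; have := congr1 (fun f : vect => f n) e.
  rewrite /scal !fctE.
  have -> : z + conjc z = s2%:C - 2.
    by apply: complexP => /=; rewrite /g; lra.
  by rewrite mulrBl => <-; ring.
have qe := quadratic_eigenvector eq2 hz.
set p0 := U y - scal (conjc z) y in qe.
have op0 : orth l p0.
  by rewrite /p0 scalN1; apply: orthD => //; [exact: orthU|do 2 apply: orthZ => //].
have hp0 : l2 p0 by case: op0.
case: (eqVneq (nsq p0) 0) => [e0|n0].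
  have /eqP := nsq_eq0 hp0 e0; rewrite subr_eq0 => /eqP uy.
  by exists y, (conjc z); rewrite hz2; split.
have p0pos : 0 < nsq p0 by rewrite lt_def n0 nsq_ge0.
pose t : R := (Num.sqrt (nsq p0))^-1.
have t2 : t ^+ 2 = (nsq p0)^-1 by rewrite /t exprVn sqr_sqrtr// ltW.
exists (scal t%:C p0), z; rewrite hz1; split => //.
- exact: orthZ.
- by rewrite nsqZ// sqm_real t2 mulVf.
- by rewrite UZ qe !scalA mulrC.
Qed.

Let eigen_rcons l phi z : eigen_orthonormal l -> orth l phi -> nsq phi = 1 ->
  U phi = scal z phi -> eigen_orthonormal (rcons l phi).
Proof.
move=> [h1 h2 h3] [hphi ophi] nphi uphi.
split=> [j|j|j k]; rewrite size_rcons !ltnS ?nth_rcons.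
- rewrite leq_eqVlt => /orP[/eqP ->|hj]; first by rewrite ltnn eqxx.
  by rewrite hj; apply: h1.
- rewrite leq_eqVlt => /orP[/eqP ->|hj]; first by rewrite ltnn eqxx; exists z.
  by rewrite hj; apply: h2.
- rewrite [(j <= _)%N]leq_eqVlt => /orP[/eqP ->|hj].
    rewrite ltnn eqxx leq_eqVlt => /orP[/eqP ->|hk].
      by rewrite ltnn !eqxx dot_self// nphi.
    rewrite hk dotC//; last exact: h1.
    by rewrite ophi// conjc0 (gtn_eqF hk).
  rewrite leq_eqVlt => /orP[/eqP ->|hk].
    by rewrite hj ltnn eqxx ophi// (ltn_eqF hj).
  by rewrite hj hk h3.
Qed.

Let residK l x : eigen_orthonormal l -> l2 x -> resid l (K x) = K (resid l x).
Proof.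
move=> hl hx; have [h1 h2 _] := hl; rewrite /resid KD KN; congr (_ - _).
have K0 : K 0 = 0 by have := KD 0 0; rewrite addr0 -[LHS]addr0 => /addrI <-.
rewrite (big_morph K KD K0); apply: eq_bigr => j _.
have hj := h1 j (ltn_ord j); have [z hz] := h2 j (ltn_ord j).
have hz1 := eigenvalue_sqm hj (nsq_unit hl (ltn_ord j)) hz.
rewrite KZ dotK// (eigenV hz1 hz) dotDl//; last exact: l2Z.
rewrite dotZl// conjcK /K hz.
by apply/funext => n; rewrite /scal !fctE; ring.
Qed.

Let residD l x y : eigen_orthonormal l -> l2 x -> l2 y ->
  resid l (x + y) = resid l x + resid l y.
Proof.
move=> [h1 _ _] hx hy; rewrite /resid addrACA -opprD -big_split /=.
congr (_ - _); apply: eq_bigr => j _; rewrite dotDr//; last exact: h1.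
by apply/funext => n; rewrite /scal !fctE mulrDl.
Qed.

(** The greedy eigenvectors [phi k] tend weakly to [0] by Bessel's inequality, so
    [K (phi k)] tends to [0]; as [K (phi k)] realizes the norm of [K] on the
    complement of its predecessors, and [K] commutes with the projection [resid],
    the residual of [K x] tends to [0] for every [x]. Density of the range of [K]
    extends this to all vectors. *)
Theorem spectral_theorem : exists phi : nat -> vect,
  orthonormal_basis phi /\
  forall k, exists z, [/\ U (phi k) = scal z (phi k), sqm z = 1 & 0 < sqm (1 + z)].
Proof.
have ex l : exists phi, eigen_orthonormal l -> exists z,
    [/\ orth l phi, nsq phi = 1, U phi = scal z phi, 0 < sqm (1 + z) &
    forall x, orth l x -> nsq (K x) <= sqm (1 + z) * nsq x].
  have [hl|hl] := pselect (eigen_orthonormal l); last by exists 0.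
  by have [phi [z hz]] := next_eigenvector hl; exists phi => _; exists z.
have [g hg] := choice ex.
pose ls k := iter k (fun l => rcons l (g l)) [::].
pose phi k := g (ls k).
have hls k : eigen_orthonormal (ls k).
  elim: k => [|k ih] //=; have [z [h1 h2 h3 _ _]] := hg _ ih.
  exact: eigen_rcons h3.
have sz k : size (ls k) = k by elim: k => //= k ih; rewrite size_rcons ih.
have nt k j : (j < k)%N -> nth 0 (ls k) j = phi j.
  elim: k => // k ih; rewrite ltnS leq_eqVlt /= nth_rcons sz => /orP[/eqP ->|hj].
    by rewrite ltnn eqxx.
  by rewrite hj ih.
have hphi k : exists z, [/\ orth (ls k) (phi k), nsq (phi k) = 1, U (phi k) = scal z (phi k),
   0 < sqm (1 + z) & forall x, orth (ls k) x -> nsq (K x) <= sqm (1 + z) * nsq x] := hg _ (hls k).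
have l2phi k : l2 (phi k) by have [z [[]]] := hphi k.
have onb j k : l2dot (phi j) (phi k) = (j == k)%:R.
  have [_ _ h] := hls (j + k).+1.
  by rewrite -(nt (j + k).+1 j) ?ltnS ?leq_addr// -(nt (j + k).+1 k) ?ltnS ?leq_addl// h// sz ltnS ?leq_addr ?leq_addl.
have residE m psi : resid (ls m) psi = fun n => psi n - \sum_(k < m) l2dot (phi k) psi * phi k n.
  apply/funext => n; rewrite /resid fctE fct_sumE sz; congr (_ - _); apply: eq_bigr => j _.
  by rewrite /scal nt.
have bessel M n : \sum_(j < M) sq (phi j) n <= 1.
  have hd := l2_delta (R := R) n; have := nsq_resid (hls M) hd; rewrite nsq_delta sz => ->.
  have [hr _] := resid_orth (hls M) hd.
  rewrite (_ : \sum_(j < M) sqm _ = \sum_(j < M) sq (phi j) n) ?lerDr ?nsq_ge0//.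
  by apply: eq_bigr => j _; rewrite nt// dotC// dot_delta sqm_conj.
have small e : 0 < e -> exists m, nsq (K (phi m)) < e.
  move=> e0; have e2 : 0 < e / 2 by rewrite divr_gt0.
  have [N hN] := psum_decay e2.
  have B0 : 0 <= B by have /andP[] := c_bound 0; exact: le_trans.
  have d0 : 0 < e / 2 / (B + 1) by rewrite divr_gt0//; lra.
  have [m hm] : exists m, psum (sq (phi m)) N < e / 2 / (B + 1).
    apply: contrapT => hn.
    have hge m : e / 2 / (B + 1) <= psum (sq (phi m)) N.
      by rewrite leNgt; apply/negP => h; apply: hn; exists m.
    pose M := Num.bound (2 * N%:R / (e / 2 / (B + 1))).
    have hM : 2 * N%:R / (e / 2 / (B + 1)) < M%:R.
      by apply: archi_boundP; apply: divr_ge0; [apply: mulr_ge0|exact: ltW].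
    have : M%:R * (e / 2 / (B + 1)) <= 2 * N%:R.
      apply: le_trans (_ : psum (fun n => \sum_(j < M) sq (phi j) n) N <= _).
        rewrite psum_sum -[X in X%:R]card_ord mulr_natl -sumr_const.
        by apply: ler_sum => j _; apply: hge.
      apply: le_trans (le_psum N (bessel M)) _.
      by rewrite /psum sumr_const_nat subn0 -[leLHS]mulr_natr -[1 + 1]/(2%:R). 
    by rewrite -ler_pdivlMr// leNgt hM.
  exists m; have [z [_ n1 _ _ _]] := hphi m.
  apply: le_lt_trans (hN _ (l2phi m) _) _; first by rewrite n1; lra.
  have p0 := psum_ge0 N (sq_ge0 (phi m)).
  have : B * psum (sq (phi m)) N <= (B + 1) * psum (sq (phi m)) N by nra.
  have : (B + 1) * psum (sq (phi m)) N < e / 2.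
    by rewrite mulrC -ltr_pdivlMr//; lra.
  by lra.
exists phi; split; last by move=> k; have [z [[h0 _] h1 h2 h3 _]] := hphi k;
  exists z; split=> //; apply: eigenvalue_sqm h2.
split=> [k|//|psi /in_l2E hpsi eps eps0]; first exact: l2_in_l2.
have e4 : 0 < eps ^+ 2 / 4 by rewrite divr_gt0// exprn_gt0.
have [x [hx hKx]] := K_dense hpsi e4.
have d0 : 0 < eps ^+ 2 / 4 / (nsq x + 1).
  by rewrite divr_gt0//; have := nsq_ge0 hx; lra.
have [m hm] := small _ d0.
have [z [[hm0 _] hm1 hm2 _ hm4]] := hphi m.
have ez : nsq (K (phi m)) = sqm (1 + z).
  rewrite /K hm2 -[X in _ + X]scal1 (_ : _ + _ = scal (1 + z) (phi m)).
    by rewrite nsqZ// hm1 mulr1.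
  by apply/funext => n; rewrite /scal !fctE; ring.
exists m, (fun k => l2dot (phi k) psi).
rewrite -residE l2sqE ?lte_fin; last by have [] := resid_orth (hls m) hpsi.
have hpk : l2 (psi - K x) by apply: l2B => //; exact: l2K.
have -> : resid (ls m) psi = resid (ls m) (psi - K x) + K (resid (ls m) x).
  by rewrite -residK// -residD ?subrK//; exact: l2K.
have [r1 _] := resid_orth (hls m) hpk.
have ox := resid_orth (hls m) hx; have [r2 _] := ox.
apply: le_lt_trans (nsqD_le r1 (l2K r2)) _.
have b1 := nsq_resid (hls m) hpk; have b2 := nsq_resid (hls m) hx.
have s1 : 0 <= \sum_(j < size (ls m)) sqm (l2dot (nth 0 (ls m) j) (psi - K x)).
  by apply: sumr_ge0 => j _; exact: sqm_ge0.
have s2 : 0 <= \sum_(j < size (ls m)) sqm (l2dot (nth 0 (ls m) j) x).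
  by apply: sumr_ge0 => j _; exact: sqm_ge0.
have b3 := hm4 _ ox; rewrite -ez in b3.
have k0 := nsq_ge0 (l2K (l2phi m)).
have x0 := nsq_ge0 hx; have x1 := nsq_ge0 r2.
have b4 : nsq (K (phi m)) * nsq (resid (ls m) x) <= nsq (K (phi m)) * (nsq x + 1).
  by rewrite ler_wpM2l//; lra.
have b5 : nsq (K (phi m)) * (nsq x + 1) < eps ^+ 2 / 4.
  by rewrite -ltr_pdivlMr//; lra.
by lra.
Qed.

End CompactPerturbationOfMinusOne.

(** * Real CMV matrices and the Jacobi matrix [L + M] *)

Section RealCMV.
Context {R : realType}.
Local Notation C := R[i].
Local Notation vect := (int -> C).
Implicit Types (phi psi x y : vect) (z : C).

Variable a : int -> R.
Hypothesis a_lt1 : forall n, `|a n| < 1.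

Definition reflL psi := refl (fun j => (2 %| j)%Z) a psi.
Definition reflM psi := refl (fun j => ~~ (2 %| j)%Z) a psi.
Definition cmvU psi := reflL (reflM psi).
Definition cmvV psi := reflM (reflL psi).

Definition diag n : R := a n - a (n - 1).

(** The Jacobi matrix [L + M]; it satisfies [L (L + M) = LM + 1] and
    [(L + M)^2 = LM + ML + 2]. *)
Definition jac psi : vect := fun n =>
  (rr a n)%:C * psi (n + 1) + (diag n)%:C * psi n + (rr a (n - 1))%:C * psi (n - 1).

Lemma ecmvE : ecmv (fun n => (a n)%:C) = cmvU.
Proof. by rewrite /ecmv /cmvL /cmvM !Theta_sum_real. Qed.

Lemma reflL_add_reflM psi : reflL psi + reflM psi = jac psi.
Proof.
apply/funext => n; rewrite /reflL /reflM /refl /jac /diag fctE if_neg rmorphB /=.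
by case: ifP => _; ring.
Qed.

Lemma reflLK psi : reflL (reflL psi) = psi.
Proof. by apply: refl_invol => //; exact: even_parity_like. Qed.

Lemma reflMK psi : reflM (reflM psi) = psi.
Proof. by apply: refl_invol => //; exact: odd_parity_like. Qed.

Lemma l2_reflL psi : l2 psi -> l2 (reflL psi). Proof. exact: l2_refl. Qed.
Lemma l2_reflM psi : l2 psi -> l2 (reflM psi). Proof. exact: l2_refl. Qed.

Lemma dot_reflL phi psi : l2 phi -> l2 psi -> l2dot phi (reflL psi) = l2dot (reflL phi) psi.
Proof. by apply: dot_refl => //; exact: even_parity_like. Qed.

Lemma dot_reflM phi psi : l2 phi -> l2 psi -> l2dot phi (reflM psi) = l2dot (reflM phi) psi.
Proof. by apply: dot_refl => //; exact: odd_parity_like. Qed.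

Lemma reflLD x y : reflL (x + y) = reflL x + reflL y. Proof. exact: reflD. Qed.
Lemma reflMD x y : reflM (x + y) = reflM x + reflM y. Proof. exact: reflD. Qed.
Lemma reflLZ z x : reflL (scal z x) = scal z (reflL x). Proof. exact: reflZ. Qed.
Lemma reflMZ z x : reflM (scal z x) = scal z (reflM x). Proof. exact: reflZ. Qed.

Lemma cmvUD x y : cmvU (x + y) = cmvU x + cmvU y.
Proof. by rewrite /cmvU reflMD reflLD. Qed.
Lemma cmvVD x y : cmvV (x + y) = cmvV x + cmvV y.
Proof. by rewrite /cmvV reflLD reflMD. Qed.
Lemma cmvUZ z x : cmvU (scal z x) = scal z (cmvU x).
Proof. by rewrite /cmvU reflMZ reflLZ. Qed.
Lemma cmvVZ z x : cmvV (scal z x) = scal z (cmvV x).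
Proof. by rewrite /cmvV reflLZ reflMZ. Qed.
Lemma cmvUV x : cmvU (cmvV x) = x. Proof. by rewrite /cmvU /cmvV reflMK reflLK. Qed.
Lemma cmvVU x : cmvV (cmvU x) = x. Proof. by rewrite /cmvU /cmvV reflLK reflMK. Qed.
Lemma l2_cmvU x : l2 x -> l2 (cmvU x).
Proof. by move=> h; apply: l2_reflL; apply: l2_reflM. Qed.
Lemma l2_cmvV x : l2 x -> l2 (cmvV x).
Proof. by move=> h; apply: l2_reflM; apply: l2_reflL. Qed.

Lemma dot_cmvU x y : l2 x -> l2 y -> l2dot x (cmvU y) = l2dot (cmvV x) y.
Proof.
move=> h1 h2; rewrite /cmvU dot_reflL//; last exact: l2_reflM.
by rewrite dot_reflM//; exact: l2_reflL.
Qed.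

Lemma nsq_reflL x : l2 x -> nsq (reflL x) = nsq x.
Proof.
move=> h; have := dot_self (l2_reflL h); rewrite dot_reflL//; last exact: l2_reflL.
by rewrite reflLK dot_self// => -[].
Qed.

Lemma nsq_cmvU x : l2 x -> nsq (cmvU x) = nsq x.
Proof.
move=> h; have := dot_self (l2_cmvU h); rewrite dot_cmvU//; last exact: l2_cmvU.
by rewrite cmvVU dot_self// => -[].
Qed.

Lemma cmvU_add1 x : cmvU x + x = reflL (jac x).
Proof. by rewrite -reflL_add_reflM reflLD reflLK addrC. Qed.

Lemma jacM x : jac x = cmvU (reflM x) + reflM x.
Proof. by rewrite /cmvU reflMK reflL_add_reflM. Qed.

Lemma jac_reflL x : jac (reflL x) = cmvV x + x.
Proof. by rewrite -reflL_add_reflM reflLK addrC. Qed.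

Lemma jac_jac x : jac (jac x) = cmvU x + cmvV x + (x + x).
Proof.
rewrite -[in LHS](reflL_add_reflM x) -reflL_add_reflM reflLD reflMD reflLK reflMK.
rewrite -/(cmvU x) -/(cmvV x) [x + cmvU x]addrC -!addrA; congr (_ + _).
by rewrite addrCA.
Qed.

Lemma l2_jac x : l2 x -> l2 (jac x).
Proof. by move=> h; rewrite -reflL_add_reflM; apply: l2D; [exact: l2_reflL|exact: l2_reflM]. Qed.

(** Three times the sum of the squares of the entries of [jac] in column [n]; the
    factor comes from Cauchy-Schwarz on rows with three entries. *)
Definition weight n : R := 3 * (rr a (n - 1) ^+ 2 + diag n ^+ 2 + rr a n ^+ 2).

Lemma rr2_bound n : 0 <= rr a n ^+ 2 <= 1.
Proof. by rewrite sqr_ge0 rr_sqr// gerBl sqr_ge0. Qed.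

Lemma weight_bound n : 0 <= weight n <= 18.
Proof.
have := rr2_bound n; have := rr2_bound (n - 1).
have := a_lt1 n; have := a_lt1 (n - 1); rewrite !ltr_norml /weight /diag.
move=> /andP[h1 h2] /andP[h3 h4] /andP[h5 h6] /andP[h7 h8].
have h9 : 0 <= (a n - a (n - 1)) ^+ 2 by exact: sqr_ge0.
have h10 : (a n - a (n - 1)) ^+ 2 <= 4 by rewrite expr2; nra.
by apply/andP; split; lra.
Qed.

Lemma sqm_jac_le psi n : sq (jac psi) n <=
  3 * (rr a n ^+ 2 * sq psi (n + 1) + diag n ^+ 2 * sq psi n + rr a (n - 1) ^+ 2 * sq psi (n - 1)).
Proof.
rewrite /sq /jac -!sqm_real -!sqmM.
set u := _ * _; set v := (diag n)%:C * _; set w := (rr a (n - 1))%:C * _.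
case: u v w => u1 u2 [v1 v2] [w1 w2]; rewrite /sqm /=.
have := sqr_ge0 (u1 - v1); have := sqr_ge0 (u1 - w1); have := sqr_ge0 (v1 - w1).
have := sqr_ge0 (u2 - v2); have := sqr_ge0 (u2 - w2); have := sqr_ge0 (v2 - w2).
by rewrite !expr2; nra.
Qed.

Lemma nsq_add1_le x : l2 x -> nsq (cmvU x + x) <= sumZ (fun n => weight n * sq x n).
Proof.
move=> h; rewrite cmvU_add1 nsq_reflL; last exact: l2_jac.
pose u n := rr a (n - 1) ^+ 2 * sq x n.
pose v n := rr a (n - 1) ^+ 2 * sq x (n - 1).
pose w n := diag n ^+ 2 * sq x n.
have hu : summ u.
  apply: summ_le (h) => n; rewrite /u ger0_norm; last by apply: mulr_ge0; rewrite ?sqr_ge0 ?sq_ge0.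
  by have /andP[? ?] := rr2_bound (n - 1); rewrite ler_piMl// sq_ge0.
have hv : summ v.
  apply: (@summ_le _ v (sq (fun n => x (n - 1)))); last exact: l2_shiftN.
  move=> n; rewrite /v ger0_norm; last by apply: mulr_ge0; rewrite ?sqr_ge0 ?sq_ge0.
  by have /andP[? ?] := rr2_bound (n - 1); rewrite ler_piMl// sq_ge0.
have hw : summ w.
  apply: summ_le (summZ 18 h) => n; rewrite /w ger0_norm; last by apply: mulr_ge0; rewrite ?sqr_ge0 ?sq_ge0.
  apply: ler_wpM2r; first exact: sq_ge0.
  have := weight_bound n; rewrite /weight.
  by have := rr2_bound n; have := rr2_bound (n - 1); lra.
have hu1 := summ_shift hu; have hv1 := summ_shift hv.
apply: le_trans (_ : 3 * (sumZ (fun n => u (n + 1)) + sumZ w + sumZ v) <= _).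
  rewrite -!sumZD//; last exact: summD.
  rewrite -sumZZ; last by do 2 apply: summD => //.
  apply: le_sumZ; [exact: l2_jac|by apply: summZ; do 2 apply: summD => //|].
  by move=> n; rewrite /u addrK; exact: sqm_jac_le.
rewrite (sumZ_shift hu) -(sumZ_shift hv) -!sumZD//; last exact: summD.
rewrite -sumZZ; last by do 2 apply: summD => //.
apply: le_sumZ; first by apply: summZ; do 2 apply: summD => //.
  apply: summ_le (summZ 18 h) => n; have /andP[w0 w1] := weight_bound n.
  rewrite ger0_norm; last by apply: mulr_ge0; rewrite ?sq_ge0.
  by apply: ler_wpM2r => //; exact: sq_ge0.
by move=> n; rewrite /u /v /w /weight addrK; lra.
Qed.

Hypothesis vanishing : forall e, 0 < e -> exists N, forall n, ~~ in_window N n -> weight n <= e.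

Lemma in_windowE N n : in_window N n = (- N%:Z <= n < N%:Z).
Proof. by case: n => k /=; lia. Qed.

Lemma in_windowS_pred N n : ~~ in_window N.+1 n -> ~~ in_window N (n - 1).
Proof. by rewrite !in_windowE; lia. Qed.

Lemma in_windowS_succ N n : ~~ in_window N.+1 n -> ~~ in_window N (n + 1).
Proof. by rewrite !in_windowE; lia. Qed.

Lemma in_window_le N M n : (N <= M)%N -> in_window N n -> in_window M n.
Proof. by rewrite !in_windowE; lia. Qed.

(** Here [jac phi = (1 + z) L phi] and [jac (L phi) = (1 + conjc z) phi]. Where the
    entries of [jac] are small compared with [1 + z], the values of [phi] and
    [L phi] at a site are at most half the largest ones at its neighbours; this
    iterates to a geometric decay. *)
Lemma eigenvector_decay phi z : l2 phi -> cmvU phi = scal z phi -> sqm z = 1 ->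
  0 < sqm (1 + z) -> exp_decaying phi.
Proof.
move=> hphi uphi hz hz1.
set q := sqm (1 + z) in hz1.
have vphi : cmvV phi = scal (conjc z) phi.
  rewrite -[in RHS](cmvVU phi) uphi cmvVZ scalA conj_mul hz.
  by apply/funext => n; rewrite /scal mul1r.
have hL := l2_reflL hphi.
have e1 : jac phi = scal (1 + z) (reflL phi).
  rewrite -(reflLK (jac phi)) -cmvU_add1 uphi -reflLZ; congr reflL.
  by apply/funext => n; rewrite /scal !fctE; ring.
have e2 : jac (reflL phi) = scal (1 + conjc z) phi.
  by rewrite jac_reflL vphi; apply/funext => n; rewrite /scal !fctE; ring.
have q' : sqm (1 + conjc z) = q by rewrite /q -[in LHS](conjc1 R) -conjD sqm_conj.
have q4 : 0 < q / 4 by rewrite divr_gt0.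
have [N hN] := vanishing q4.
pose Q := nsq phi.
have Q0 : 0 <= Q by exact: nsq_ge0.
have step psi chi Y n : (forall m, sq (jac psi) m = q * sq chi m) -> 0 <= Y ->
    ~~ in_window N n -> sq psi n <= Y -> sq psi (n + 1) <= Y -> sq psi (n - 1) <= Y ->
    sq chi n <= Y / 4.
  move=> hj Y0 hn b1 b2 b3; have := sqm_jac_le psi n; rewrite hj.
  have := hN n hn; rewrite /weight => hw hs.
  have c1 := sqr_ge0 (rr a n); have c2 := sqr_ge0 (rr a (n - 1)); have c3 := sqr_ge0 (diag n).
  have d1 := ler_wpM2l c1 b2; have d2 := ler_wpM2l c2 b3; have d3 := ler_wpM2l c3 b1.
  have : q * sq chi n <= 3 * (rr a (n - 1) ^+ 2 + diag n ^+ 2 + rr a n ^+ 2) * Y by lra.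
  have d4 := ler_wpM2r Y0 hw.
  move=> /le_trans /(_ d4); rewrite -mulrA ler_pM2l//; lra.
have main j n : ~~ in_window (N + j) n ->
    sq phi n <= Q * (4^-1) ^+ j /\ sq (reflL phi) n <= Q * (4^-1) ^+ j.
  elim: j n => [|j ih] n.
    by move=> _; rewrite expr0 mulr1; split; [|rewrite /Q -nsq_reflL//]; exact: sq_le_nsq.
  rewrite addnS => hn.
  have [x0 y0] : sq phi n <= Q * (4^-1) ^+ j /\ sq (reflL phi) n <= Q * (4^-1) ^+ j.
    by apply: ih; apply: contra hn; apply: in_window_le.
  have [x1 y1] := ih _ (in_windowS_succ hn).
  have [x2 y2] := ih _ (in_windowS_pred hn).
  have hn' : ~~ in_window N n by apply: contra hn; apply: in_window_le; lia.
  have Y0 : 0 <= Q * (4^-1) ^+ j by rewrite mulr_ge0// exprn_ge0// invr_ge0.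
  rewrite exprSr mulrA; split.
    by apply: (step (reflL phi)) => // m; rewrite e2 /sq /scal sqmM q'.
  by apply: (step phi) => // m; rewrite e1 /sq /scal sqmM.
exists (Num.sqrt Q * 2 ^+ N.+1 + 1), (ln 2); split.
- by rewrite ltr_pwDr// mulr_ge0 ?sqrtr_ge0// exprn_ge0.
- by rewrite ln_gt0// ltr1n.
move=> n; have h2 : (0 : R) < 2 by [].
have -> : expR (- (ln 2 * `|n|%:~R)) = (2^-1) ^+ `|n|%N :> R.
  have en : `|n|%:~R = `|n|%N%:R :> R by rewrite -abszE.
  rewrite en expRN expRM_natr lnK ?posrE//.
  by rewrite exprVn.
have key : sq phi n <= Q * (4^-1) ^+ (`|n| - N.+1)%N.
  case: (leqP `|n|%N N) => hn.
    have -> : (`|n| - N.+1 = 0)%N by lia.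
    by rewrite expr0 mulr1; exact: sq_le_nsq.
  have [|//] := main (`|n| - N.+1)%N n.
  by case: n hn => k /=; rewrite -leqNgt; lia.
have key2 : cabs (phi n) <= Num.sqrt Q * (2^-1) ^+ (`|n| - N.+1)%N.
  rewrite cabs_sqm; apply: le_trans (ler_wsqrtr key) _.
  rewrite sqrtrM// (_ : 4^-1 = (2^-1) ^+ 2 :> R); last by field.
  by rewrite -exprM mulnC exprM sqrtr_sqr ger0_norm// exprn_ge0// invr_ge0.
apply: le_trans key2 _; rewrite mulrDl.
apply: le_trans (_ : Num.sqrt Q * 2 ^+ N.+1 * 2^-1 ^+ `|n|%N <= _); last first.
  by rewrite lerDl mul1r exprn_ge0// invr_ge0.
rewrite -mulrA ler_wpM2l ?sqrtr_ge0//.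
have -> : (2 : R) ^+ N.+1 = (2^-1) ^- N.+1 by rewrite exprVn invrK.
rewrite mulrC; case: (leqP `|n|%N N) => hn.
  have -> : (`|n| - N.+1 = 0)%N by lia.
  rewrite expr0 ler_pdivlMr ?exprn_gt0 ?invr_gt0// mul1r.
  by apply: ler_wiXn2l; rewrite ?invr_ge0 ?invf_le1 ?ler1n//; lia.
rewrite -exprB//; last by rewrite unitfE invr_eq0.
Qed.

End RealCMV.

(** * Density of the range of [U + 1] *)

Section Density.
Context {R : realType}.
Local Notation C := R[i].
Local Notation vect := (int -> C).
Implicit Types (phi psi chi x y : vect) (z : C).

Variable a : int -> R.
Hypothesis a_lt1 : forall n, `|a n| < 1.
Hypothesis vanishing : forall e, 0 < e -> exists N, forall n, ~~ in_window N n -> weight a n <= e.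
Hypothesis paired : forall n, (2 %| n)%Z -> a (n + 1) = a n.

Let U := cmvU a.
Let e_ n : vect := delta R n.

(** The closure of the range of [U + 1]. *)
Definition approx psi := l2 psi /\
  forall e, 0 < e -> exists x, l2 x /\ nsq (psi - (U x + x)) < e.

Lemma approx_range x : l2 x -> approx (U x + x).
Proof.
move=> h; split; first by apply: l2D => //; exact: l2_cmvU.
move=> e e0; exists x; split=> //; rewrite subrr.
by rewrite nsq0.
Qed.

Lemma approx_closed psi : l2 psi ->
  (forall e, 0 < e -> exists chi, approx chi /\ nsq (psi - chi) < e) -> approx psi.
Proof.
move=> h H; split=> // e e0; have e4 : 0 < e / 4 by rewrite divr_gt0.
have [chi [[hc hchi] n1]] := H _ e4; have [x [hx n2]] := hchi _ e4.
exists x; split=> //.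
have hk : l2 (U x + x) by apply: l2D => //; exact: l2_cmvU.
have -> : psi - (U x + x) = (psi - chi) + (chi - (U x + x)) by rewrite addrA subrK.
by apply: le_lt_trans (nsqD_le (l2B h hc) (l2B hc hk)) _; lra.
Qed.

Lemma approxD phi psi : approx phi -> approx psi -> approx (phi + psi).
Proof.
move=> [h1 H1] [h2 H2]; split; first exact: l2D.
move=> e e0; have e4 : 0 < e / 4 by rewrite divr_gt0.
have [x [hx n1]] := H1 _ e4; have [y [hy n2]] := H2 _ e4.
exists (x + y); split; first exact: l2D.
have hkx : l2 (U x + x) by apply: l2D => //; exact: l2_cmvU.
have hky : l2 (U y + y) by apply: l2D => //; exact: l2_cmvU.
have -> : phi + psi - (U (x + y) + (x + y)) = (phi - (U x + x)) + (psi - (U y + y)).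
  by rewrite /U cmvUD [X in _ - X]addrACA opprD addrACA.
by apply: le_lt_trans (nsqD_le (l2B h1 hkx) (l2B h2 hky)) _; lra.
Qed.

Lemma approxZ z psi : approx psi -> approx (scal z psi).
Proof.
move=> [h H]; split; first exact: l2Z.
move=> e e0; have s0 := sqm_ge0 z.
have d0 : 0 < e / (sqm z + 1) by rewrite divr_gt0//; lra.
have [x [hx n1]] := H _ d0; exists (scal z x); split; first exact: l2Z.
have hk : l2 (U x + x) by apply: l2D => //; exact: l2_cmvU.
have -> : scal z psi - (U (scal z x) + scal z x) = scal z (psi - (U x + x)).
  by rewrite /U cmvUZ !scalN1 !scalD !scalA [z * -1]mulrC.
rewrite nsqZ; last exact: l2B.
have n0 := nsq_ge0 (l2B h hk); move: n1; rewrite ltr_pdivlMr; last by lra.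
by nra.
Qed.

Lemma approx0 : approx 0.
Proof.
have e : U 0 + 0 = 0 by rewrite addr0 -(scal0 0) /U cmvUZ !scal0.
by rewrite -[X in approx X]e; apply: approx_range; exact: l20.
Qed.

Lemma approx_sum (I : Type) (s : seq I) (f : I -> vect) :
  (forall i, approx (f i)) -> approx (\sum_(i <- s) f i).
Proof. by move=> h; elim/big_rec: _ => [|i x _ hx]; [exact: approx0|exact: approxD]. Qed.

Lemma approx_jac x : l2 x -> approx (jac a x).
Proof. by move=> h; rewrite jacM//; apply: approx_range; exact: l2_reflM. Qed.

Lemma jac_delta n : jac a (e_ n) =
  scal (rr a (n - 1))%:C (e_ (n - 1)) + scal (diag a n)%:C (e_ n) + scal (rr a n)%:C (e_ (n + 1)).
Proof.
apply/funext => m; rewrite /jac /scal !fctE /e_ /delta.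
have -> : (m == n - 1) = (m + 1 == n) by apply/eqP/eqP; lia.
have -> : (m == n + 1) = (m - 1 == n) by apply/eqP/eqP; lia.
have [<-|h1] := eqVneq (m + 1) n.
  rewrite (_ : (m == m + 1) = false); last by lia.
  by rewrite (_ : (m - 1 == m + 1) = false) ?addrK ?mulr0; [ring|lia].
have [<-|h2] := eqVneq m n.
  by rewrite (_ : (m - 1 == m) = false) ?mulr0; [ring|lia].
by have [<-|h3] := eqVneq (m - 1) n; rewrite ?(mulr0, mulr1).
Qed.

Lemma approx_chain (y : nat -> vect) : (forall i, l2 (y i)) ->
  (forall i, approx (y i + y i.+1)) -> forall i, approx (y 0%N - scal ((-1) ^+ i) (y i)).
Proof.
move=> hy h; elim=> [|i ih].
  have -> : y 0%N - scal ((-1) ^+ 0) (y 0%N) = 0; last exact: approx0.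
  by apply/funext => n; rewrite /scal !fctE mul1r subrr.
have -> : y 0%N - scal ((-1) ^+ i.+1) (y i.+1) =
    (y 0%N - scal ((-1) ^+ i) (y i)) + scal ((-1) ^+ i) (y i + y i.+1).
  by apply/funext => n; rewrite /scal !fctE exprS; ring.
by apply: approxD => //; exact: approxZ.
Qed.

Lemma sqm_sign i : sqm ((-1) ^+ i : C) = 1.
Proof. by rewrite sqmX sqmN sqm1 expr1n. Qed.

(** At an odd site [m] the pairing makes the diagonal entry of [jac] vanish and the
    two others equal, so [delta (m - 1) + delta (m + 1)] is in the range. Along
    this chain the norms do not decrease, but the average of [M] vectors with
    alternating signs has norm [M^-1/2]. *)
Lemma approx_even n : (2 %| n)%Z -> approx (e_ n).
Proof.
move=> hn; pose y i := e_ (n + (2 * i)%:Z).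
have hy i : l2 (y i) by exact: l2_delta.
have ch i : approx (y i + y i.+1).
  pose m := n + (2 * i)%:Z + 1.
  have hm : (2 %| n + (2 * i)%:Z)%Z by lia.
  have hm1 : n + (2 * i)%:Z = m - 1 by rewrite /m addrK.
  have em : a m = a (m - 1) by rewrite -hm1; exact: paired.
  have dm : diag a m = 0 by rewrite /diag em subrr.
  have rm : rr a m = rr a (m - 1) by rewrite /rr em.
  have r0 := rr_gt0 a_lt1 m.
  have -> : y i + y i.+1 = scal ((rr a m)^-1)%:C (jac a (e_ m)).
    rewrite jac_delta dm -rm /y hm1.
    have -> : n + (2 * i.+1)%:Z = m + 1 by rewrite /m; lia.
    apply/funext => k; rewrite /scal !fctE mul0r addr0 -mulrDr mulrA -rmorphM /=.
    by rewrite mulVf ?lt0r_neq0// mul1r.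
  by apply: approxZ; apply: approx_jac; exact: l2_delta.
have hch := approx_chain hy ch.
pose s M : vect := \sum_(i < M) scal ((-1) ^+ i) (y i).
have hs M : l2 (s M) by apply: l2_sum => i _; exact: l2Z.
have s0 M k : n + (2 * M)%:Z <= k -> s M k = 0.
  move=> hk; rewrite /s fct_sumE big1// => i _; rewrite /scal /y /e_ /delta.
  by case: eqP => [e|_]; [have := ltn_ord i; lia|rewrite mulr0].
have ns M : nsq (s M) = M%:R.
  elim: M => [|M ih].
    have -> : s 0%N = scal 0 0 by rewrite /s big_ord0; apply/funext => k; rewrite /scal mul0r.
    by rewrite nsqZ ?sqm0 ?mul0r//; exact: l20.
  have -> : s M.+1 = s M + scal ((-1) ^+ M) (y M) by rewrite /s big_ord_recr.
  have hz : l2 (scal ((-1) ^+ M) (y M)) by exact: l2Z.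
  rewrite nsqD// ih nsqZ// sqm_sign nsq_delta dotZr// dotC//.
  by rewrite dot_delta s0// conjc0 mulr0 mulr0 addr0 mulr1 natr1.
apply: approx_closed; first exact: l2_delta.
move=> e e0; pose M := (Num.bound e^-1).
have hM : e^-1 < M%:R by apply: archi_boundP; rewrite invr_ge0 ltW.
have M0 : 0 < M%:R :> R by apply: lt_trans hM; rewrite invr_gt0.
exists (scal (M%:R^-1)%:C (\sum_(i < M) (y 0%N - scal ((-1) ^+ i) (y i)))); split.
  by apply: approxZ; apply: approx_sum => i; apply: hch.
have -> : e_ n - scal (M%:R^-1)%:C (\sum_(i < M) (y 0%N - scal ((-1) ^+ i) (y i))) =
    scal (M%:R^-1)%:C (s M).
  rewrite sumrB -/(s M).
  have -> : y 0%N = e_ n by rewrite /y muln0 addr0.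
  apply/funext => k; rewrite /scal !fctE.
  rewrite fct_sumE sumr_const card_ord -(mulr_natl (e_ n k) M) mulrBr mulrA.
  have -> : (M%:R^-1)%:C * M%:R = 1 :> C.
    by rewrite -(rmorph_nat (real_complex R) M) -rmorphM /= mulVf// lt0r_neq0.
  by ring.
rewrite nsqZ// ns sqm_real expr2 -mulrA mulVf ?lt0r_neq0// mulr1.
by rewrite -[ltRHS]invrK ltf_pV2// ?posrE ?invr_gt0.
Qed.

(** The diagonal entries of [jac] at even sites are removed by [approx_even]; what
    remains is a chain of the vectors [rr k * delta k], which tend to [0]. *)
Lemma approx_odd n : ~~ (2 %| n)%Z -> approx (e_ n).
Proof.
move=> hn; pose y i := scal (rr a (n + (2 * i)%:Z))%:C (e_ (n + (2 * i)%:Z)).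
have hy i : l2 (y i) by apply: l2Z; exact: l2_delta.
have ch i : approx (y i + y i.+1).
  pose m := n + (2 * i)%:Z + 1.
  have hm : (2 %| m)%Z by rewrite /m; lia.
  have hm1 : n + (2 * i)%:Z = m - 1 by rewrite /m addrK.
  have rm : rr a m = rr a (m + 1) by rewrite /rr paired.
  have -> : y i + y i.+1 = jac a (e_ m) + scal (- (diag a m)%:C) (e_ m).
    rewrite jac_delta /y hm1.
    have -> : n + (2 * i.+1)%:Z = m + 1 by rewrite /m; lia.
    by rewrite rm; apply/funext => k; rewrite /scal !fctE; ring.
  apply: approxD; first by apply: approx_jac; exact: l2_delta.
  by apply: approxZ; exact: approx_even.
have hch := approx_chain hy ch.
have r0 := rr_gt0 a_lt1 n.
have -> : e_ n = scal ((rr a n)^-1)%:C (y 0%N).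
  apply/funext => k; rewrite /y muln0 addr0 /scal mulrA -rmorphM /= mulVf ?lt0r_neq0//.
  by rewrite mul1r.
apply: approxZ; apply: approx_closed => // e e0.
have [N hN] := vanishing e0.
pose i := (`|n| + N)%N.
exists (y 0%N - scal ((-1) ^+ i) (y i)); split=> //.
rewrite opprB addrC subrK nsqZ// sqm_sign mul1r nsqZ; last exact: l2_delta.
rewrite sqm_real nsq_delta mulr1.
have := hN (n + (2 * i)%:Z) _; rewrite /weight.
have -> : ~~ in_window N (n + (2 * i)%:Z) by rewrite in_windowE /i; lia.
move=> /(_ isT).
have := sqr_ge0 (rr a (n + (2 * i)%:Z - 1)); have := sqr_ge0 (diag a (n + (2 * i)%:Z)).
have : 0 < rr a (n + (2 * i)%:Z) ^+ 2 by rewrite exprn_gt0// rr_gt0.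
by lra.
Qed.

Lemma range_dense psi e : l2 psi -> 0 < e -> exists x, l2 x /\ nsq (psi - (U x + x)) < e.
Proof.
move=> h; suff [_ H] : approx psi by exact: H.
have hd n : approx (e_ n).
  by case: (boolP (2 %| n)%Z) => hn; [exact: approx_even|exact: approx_odd].
apply: approx_closed => // {}e e0; have [N hN] := nsq_trunc_small h e0.
exists (trunc N psi); split=> //.
have -> : trunc N psi = \sum_(0 <= k < N)
   (scal (psi (Posz k)) (e_ (Posz k)) + scal (psi (Negz k)) (e_ (Negz k))).
  apply/funext => n; rewrite fct_sumE /trunc /e_ /delta /scal.
  have -> : (if in_window N n then psi n else 0) =
      psum (fun m => psi m * (n == m)%:R) N.
    rewrite -(@psum_window _ _ N (N + `|n|.+1)) ?leq_addr//.
    rewrite (@psum_delta _ n) ?eqxx ?mulr1//; last by lia.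
    by move=> m /negbTE hm; rewrite eq_sym hm mulr0 if_same.
  by apply: eq_bigr => k _; rewrite fctE.
by apply: approx_sum => k; apply: approxD; exact: approxZ.
Qed.

End Density.

(** * Pure point spectrum *)

Section PurePoint.
Context {R : realType}.
Local Notation vect := (int -> R[i]).

Lemma weight_vanishing (a : int -> R) :
  (forall e, 0 < e -> exists N, forall n, ~~ in_window N n ->
     rr a n ^+ 2 <= e /\ diag a n ^+ 2 <= e) ->
  forall e, 0 < e -> exists N, forall n, ~~ in_window N n -> weight a n <= e.
Proof.
move=> h e e0; have e9 : 0 < e / 9 by rewrite divr_gt0.
have [N hN] := h _ e9; exists N.+1 => n hn.
have [h1 _] := hN _ (in_windowS_pred hn).
have [h2 h3] : rr a n ^+ 2 <= e / 9 /\ diag a n ^+ 2 <= e / 9.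
  by apply: hN; apply: contra hn; apply: in_window_le.
by rewrite /weight; lra.
Qed.

Theorem cmv_pure_point (a : int -> R) : (forall n, `|a n| < 1) ->
  (forall e, 0 < e -> exists N, forall n, ~~ in_window N n -> weight a n <= e) ->
  (forall n, (2 %| n)%Z -> a (n + 1) = a n) ->
  pure_point_exp_decaying (ecmv (fun n => (a n)%:C)).
Proof.
move=> a1 hv hp; rewrite ecmvE.
have [phi [hon hphi]] := @spectral_theorem R (cmvU a) (cmvV a) (weight a) 18
  (cmvUD a) (cmvUZ a) (cmvVD a) (cmvVZ a) (cmvUV a1) (cmvVU a1)
  (l2_cmvU a1) (l2_cmvV a1) (dot_cmvU a1) (weight_bound a1) hv (nsq_add1_le a1)
  (fun psi e => @range_dense R a a1 hv hp psi e).
exists phi; split=> // k.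
have [h1 h2 _] := hon; have hl2 := in_l2E (h1 k).
have [z [uz z1 z2]] := hphi k; split; last exact: (eigenvector_decay a1 hv hl2 uz z1 z2).
split=> //; last by exists z => n; rewrite uz.
apply: contrapT => hn; have p0 : phi k = 0.
  apply/funext => n; apply/eqP/negPn/negP => hne; apply: hn; by exists n.
have := h2 k k; rewrite p0 eqxx dot0r; last exact: l20.
by move=> /eqP; rewrite eq_sym oner_eq0.
Qed.

End PurePoint.

(** * Roots of unity *)

Section RootsOfUnity.
Context {R : realType}.
Local Notation C := R[i].

Definition expi (x : R) : C := cos x +i* sin x.

Lemma expiD x y : expi (x + y) = expi x * expi y.
Proof. by apply: complexP; rewrite /= ?cosD ?sinD; ring. Qed.

Lemma expi0 : expi 0 = 1.
Proof. by rewrite /expi cos0 sin0. Qed.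

Lemma expiX x n : expi x ^+ n = expi (n%:R * x).
Proof.
elim: n => [|n ih]; first by rewrite mul0r expi0.
by rewrite exprS ih -expiD -natr1 mulrDl mul1r addrC.
Qed.

Lemma expi_2pi : expi (2 * pi) = 1.
Proof.
by rewrite mulr_natl /expi -[_ *+ 2]add0r cosD2pi sinD2pi cos0 sin0.
Qed.

Lemma sqm_expi x : sqm (expi x) = 1.
Proof. by rewrite /sqm /= cos2Dsin2. Qed.

Lemma conjX (z : C) n : conjc (z ^+ n) = conjc z ^+ n.
Proof. by elim: n => [|n ih]; rewrite ?expr0 ?conjc1// !exprS conjM ih. Qed.

Lemma conj_sum (I : Type) (s : seq I) (P : pred I) (f : I -> C) :
  conjc (\sum_(i <- s | P i) f i) = \sum_(i <- s | P i) conjc (f i).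
Proof. by apply: big_morph; [exact: conjD|exact: conjc0]. Qed.

(** Characters of the cyclic group of order [N] are orthogonal. Sampling the
    spectrum at roots of unity avoids integrals over it. *)
Lemma parseval (N M : nat) (z w : 'I_M -> C) :
  (forall i, sqm (z i) = 1) -> (forall i, z i ^+ N = 1) -> injective z ->
  \sum_(t < N) sqm (\sum_i z i ^+ t * w i) = N%:R * \sum_i sqm (w i).
Proof.
move=> hz hN hi.
suff : (\sum_(t < N) sqm (\sum_i z i ^+ t * w i))%:C = (N%:R * \sum_i sqm (w i))%:C by case.
have orth i k : \sum_(t < N) (conjc (z i) * z k) ^+ t = if i == k then N%:R else 0.
  case: eqP => [->|ne].
    by rewrite conj_mul hz; under eq_bigr do rewrite expr1n; rewrite sumr_const card_ord.
  have hne : conjc (z i) * z k - 1 != 0.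
    rewrite subr_eq0; apply/eqP => e; apply: ne; apply: hi.
    by rewrite -[RHS]mul1r -[1](_ : z i * conjc (z i) = 1) -?mulrA ?e ?mulr1// mulrC conj_mul hz.
  apply: (mulfI hne); rewrite mulr0 -subrX1 exprMn hN mulr1.
  by rewrite -conjX hN conjc1 subrr.
rewrite rmorph_sum /=.
transitivity (\sum_(t < N) \sum_i \sum_k conjc (w i) * w k * (conjc (z i) * z k) ^+ t).
  apply: eq_bigr => t _; rewrite -conj_mul.
  have -> : conjc (\sum_i z i ^+ t * w i) = \sum_i conjc (z i) ^+ t * conjc (w i).
    by rewrite conj_sum; apply: eq_bigr => i _; rewrite conjM conjX.
  rewrite mulr_suml; apply: eq_bigr => i _; rewrite mulr_sumr; apply: eq_bigr => k _.
  by rewrite exprMn; ring.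
rewrite exchange_big /= rmorphM /= rmorph_sum /= rmorph_nat mulr_sumr.
apply: eq_bigr => i _; rewrite exchange_big /=.
under eq_bigr => k _ do rewrite -mulr_sumr orth.
rewrite (bigD1 i)//= eqxx big1 ?addr0; last first.
  by move=> k hk; rewrite eq_sym (negbTE hk) mulr0.
by rewrite conj_mul mulrC.
Qed.

End RootsOfUnity.

(** * Evolution of finitely supported vectors *)

Section FiniteWindows.
Context {R : realType}.
Local Notation C := R[i].
Local Notation vect := (int -> C).
Implicit Types (phi psi chi : vect) (z : C) (start : pred int) (j t W : nat).

Variable a : int -> R.
Hypothesis a_lt1 : forall n, `|a n| < 1.

Definition supported j psi := forall n : int, (j < `|n|)%N -> psi n = 0.

Lemma supported_refl start j psi : supported j psi -> supported j.+1 (refl start a psi).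
Proof.
move=> h n hn; rewrite /refl.
by case: (start n); rewrite !h ?mulr0 ?addr0 ?subr0//; lia.
Qed.

Lemma supported_cmvU j psi : supported j psi -> supported j.+2 (cmvU a psi).
Proof. by move=> h; do 2 apply: supported_refl. Qed.

Lemma supported_iter t : supported t.*2 (iter t (cmvU a) (delta R 0)).
Proof.
elim: t => [|t ih] /=; last exact: supported_cmvU.
by move=> n hn; rewrite /delta; case: eqP => // e; move: hn; rewrite e.
Qed.

Lemma psum_refl start phi psi j W : parity_like start -> supported j psi -> (j.+1 < W)%N ->
  psum (fun n => conjc (phi n) * refl start a psi n) W =
  psum (fun n => conjc (refl start a phi n) * psi n) W.
Proof.
move=> alt h hj; apply/eqP; rewrite -subr_eq0 -psumB.
rewrite (eq_psum _ (fun n => refl_flux a alt phi psi n)) psum_telescope /flux.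
by rewrite !h ?mulr0 ?subrr ?mulr0 ?if_same ?subrr//; lia.
Qed.

Lemma psum_cmvU phi psi j W : supported j psi -> (j.+2 < W)%N ->
  psum (fun n => conjc (phi n) * cmvU a psi n) W =
  psum (fun n => conjc (cmvV a phi n) * psi n) W.
Proof.
move=> h hj; rewrite (psum_refl _ even_parity_like (supported_refl _ h))//.
by rewrite (psum_refl _ odd_parity_like h)//; lia.
Qed.

(** The overlap with a formal eigenfunction evolves by a phase, although the
    eigenfunction need not be square-summable. *)
Lemma psum_eigen phi z t W : cmvU a phi = scal z phi -> sqm z = 1 -> (t.*2.+2 < W)%N ->
  psum (fun n => conjc (phi n) * iter t (cmvU a) (delta R 0) n) W = z ^+ t * conjc (phi 0).
Proof.
move=> h hz.
have hV : cmvV a phi = scal (conjc z) phi.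
  rewrite -[in RHS](cmvVU a_lt1 phi) h cmvVZ scalA conj_mul hz.
  by apply/funext => n; rewrite /scal mul1r.
elim: t => [|t ih] hW.
  have d0 n : n != 0 -> conjc (phi n) * delta R 0 n = 0.
    by move=> /negbTE hn; rewrite /delta hn mulr0.
  rewrite /= (psum_delta d0); last by lia.
  by rewrite /delta eqxx mulr1 mul1r.
rewrite iterS (psum_cmvU _ (@supported_iter t)); last by lia.
rewrite hV exprS -mulrA -ih; last by lia.
rewrite /psum mulr_sumr; apply: eq_bigr => k _.
by rewrite /scal !conjM conjcK mulrDr !mulrA.
Qed.

Lemma l2dot_trunc N phi psi : l2dot (trunc N phi) psi = psum (fun n => conjc (phi n) * psi n) N.
Proof.
have e : forall (u : int -> C), psum (fun n => complex.Re (u n)) N = complex.Re (psum u N) /\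
   psum (fun n => complex.Im (u n)) N = complex.Im (psum u N).
  move=> u; rewrite /psum; elim: N => [|N [ih1 ih2]]; first by rewrite !big_geq.
  by rewrite !big_nat_recr//= ih1 ih2 !(ReD, ImD).
have [e1 e2] := e (fun n => conjc (phi n) * psi n).
apply: complexP => /=; rewrite -?e1 -?e2 -sumZ_window; apply: eq_sumZ => n;
  by rewrite /trunc; case: ifP => _; rewrite ?conjc0 ?mul0r.
Qed.

End FiniteWindows.

(** * Bounded formal eigenfunctions for eventually constant coefficients *)

Section PlaneWaves.
Context {R : realType}.
Local Notation C := R[i].
Local Notation vect := (int -> C).
Implicit Types (phi psi chi : vect) (z : C) (s : R).

Definition oddext (b : nat -> R) (n : int) : R :=
  match n with Posz k => b k | Negz k => - b k end.

Variable b : nat -> R.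
Hypothesis b_lt1 : forall k, `|b k| < 1.

Let a := oddext b.

Lemma oddext_lt1 n : `|oddext b n| < 1.
Proof. by case: n => k /=; rewrite ?normrN. Qed.

Let r k := rr a (Posz k).
Let r_gt0 k : 0 < r k. Proof. exact: (rr_gt0 oddext_lt1). Qed.
Let r_neq0 k : r k != 0. Proof. exact: lt0r_neq0. Qed.
Let r_Negz k : rr a (Negz k) = r k. Proof. by rewrite /r /rr /= sqrrN. Qed.

(** Pairs of consecutive values of the solution on the half-line with initial
    values [0] and [1]. *)
Fixpoint halfline s k : R * R :=
  if k is k'.+1 then
    let: (u, v) := halfline s k' in
    (v, ((s - (b k'.+1 - b k')) * v - r k' * u) / r k'.+1)
  else (0, 1).

Definition halfwave s k := (halfline s k).1.
Arguments halfwave : simpl never.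
Local Notation y := halfwave.

Let y_snd s k : (halfline s k).2 = y s k.+1.
Proof. by rewrite /halfwave /=; case: (halfline s k). Qed.

Let y_rec s k : r k.+1 * y s k.+2 + (b k.+1 - b k) * y s k.+1 + r k * y s k = s * y s k.+1.
Proof.
have -> : y s k.+2 = ((s - (b k.+1 - b k)) * y s k.+1 - r k * y s k) / r k.+1.
  rewrite -y_snd -y_snd [halfline s k.+1]/= /halfwave.
  by case: (halfline s k).
by field; exact: r_neq0.
Qed.

(** An odd solution of [jac v = s v] exists because the Jacobi matrix of an odd
    extension is invariant under reflection about the origin. *)
Definition standing s (n : int) : R :=
  match n with Posz k => halfwave s k | Negz k => - halfwave s k.+1 end.

Definition standingC s : vect := fun n => (standing s n)%:C.

Lemma jac_standing s : jac a (standingC s) = scal s%:C (standingC s).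
Proof.
apply/funext => n; rewrite /jac /scal /standingC -!rmorphM -!rmorphD /=; congr (_%:C).
case: n => [[|k]|k].
- have -> : Posz 0 - 1 = Negz 0 by lia.
  by rewrite /= r_Negz -/(r 0) /halfwave /=; ring.
- have -> : Posz k.+1 - 1 = Posz k by lia.
  have -> : Posz k.+1 + 1 = Posz k.+2 by lia.
  rewrite /diag; have -> : Posz k.+1 - 1 = Posz k by lia.
  by rewrite /= -/(r _) -/(r _) y_rec.
- have -> : Negz k - 1 = Negz k.+1 by lia.
  have e : standing s (Negz k + 1) = - y s k.
    by case: k => [|k]; [rewrite /= /halfwave /= oppr0|rewrite (_ : Negz k.+1 + 1 = Negz k)//; lia].
  rewrite e /diag; have -> : Negz k - 1 = Negz k.+1 by lia.
  rewrite !r_Negz /= [RHS]mulrN. rewrite -y_rec; ring.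
Qed.

Let y_bounded k : exists B, forall s, 0 <= s <= 2 -> `|y s k| <= B /\ `|y s k.+1| <= B.
Proof.
elim: k => [|k [B ih]].
  by exists 1 => s _; rewrite /halfwave /= normr0 normr1.
exists (B + (4 * B + B) / r k.+1) => s hs; have [h1 h2] := ih s hs.
have B0 : 0 <= B by apply: le_trans h1.
have q0 : 0 <= (4 * B + B) / r k.+1 by apply: divr_ge0; [lra|exact: ltW].
split; first by lra.
have e : r k.+1 * y s k.+2 = (s - (b k.+1 - b k)) * y s k.+1 - r k * y s k.
  by have := y_rec s k; lra.
have : `|y s k.+2| * r k.+1 <= 4 * B + B.
  rewrite -[X in _ * X]gtr0_norm// -normrM mulrC e.
  apply: le_trans (ler_normB _ _) _; rewrite !normrM.
  apply: lerD.
    apply: ler_pM => //.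
    have /andP[? ?] := hs; have := b_lt1 k; have := b_lt1 k.+1; rewrite !ltr_norml ler_norml; lra.
  have r1 : `|r k| <= 1 by rewrite gtr0_norm//; apply: (rr_le1 oddext_lt1).
  by rewrite -[leRHS]mul1r; apply: ler_pM.
by rewrite -ler_pdivlMr// => ?; lra.
Qed.

Variable K0 : nat.
Hypothesis b_const : forall k, (K0 <= k)%N -> b k = b K0.
Let rho0 := r K0.

(** In the region of constant coefficients, with [q = s / rho0], the recursion
    is [y'' = q y' - y], which preserves the form [y'^2 + y^2 - q y y']; it is
    positive definite for [0 <= q <= 1]. *)
Let y_tail s k : 0 <= s <= rho0 ->
  y s (K0 + k) ^+ 2 + y s (K0 + k).+1 ^+ 2 <=
  3 * (y s K0 ^+ 2 + y s K0.+1 ^+ 2).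
Proof.
move=> /andP[s0 s1]; pose q := s / rho0.
have rho_gt0 : 0 < rho0 by exact: r_gt0.
have q0 : 0 <= q by rewrite divr_ge0// ltW.
have q1 : q <= 1 by rewrite ler_pdivrMr// mul1r.
pose Q k := y s (K0 + k) ^+ 2 + y s (K0 + k).+1 ^+ 2 - q * y s (K0 + k) * y s (K0 + k).+1.
have rc j : r (K0 + j) = rho0 by rewrite /rho0 /r /rr /a /= b_const// leq_addr.
have Qc j : Q j = Q 0%N.
  elim: j => // j <-; rewrite /Q !addnS.
  have := y_rec s (K0 + j); rewrite -!addnS !rc b_const ?leq_addr// [b (K0 + j)]b_const ?leq_addr//.
  rewrite subrr mul0r addr0 !addnS => h.
  have -> : y s (K0 + j).+2 = q * y s (K0 + j).+1 - y s (K0 + j).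
    apply: (mulfI (lt0r_neq0 rho_gt0)).
    rewrite (_ : rho0 * (q * _ - _) = s * y s (K0 + j).+1 - rho0 * y s (K0 + j)).
      by lra.
    by rewrite /q; field; exact: lt0r_neq0.
  by ring.
have := Qc k; rewrite /Q addn0.
set u := y s (K0 + k); set v := y s (K0 + k).+1; set u0 := y s K0; set v0 := y s K0.+1.
move=> e.
have h1 : u ^+ 2 + v ^+ 2 <= 2 * (u ^+ 2 + v ^+ 2 - q * u * v).
  have := sqr_ge0 (u - v); have := sqr_ge0 (u + v); rewrite !expr2; nra.
have h2 : u0 ^+ 2 + v0 ^+ 2 - q * u0 * v0 <= 3 / 2 * (u0 ^+ 2 + v0 ^+ 2).
  have := sqr_ge0 (u0 - v0); have := sqr_ge0 (u0 + v0); rewrite !expr2; nra.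
lra.
Qed.

Let rho0_le1 : rho0 <= 1. Proof. exact: (rr_le1 oddext_lt1). Qed.

Let standing_bounded : exists B, 0 <= B /\
  forall s n, 0 <= s <= rho0 -> standing s n ^+ 2 <= B.
Proof.
have core : exists B, 0 <= B /\ forall s k, 0 <= s <= 2 -> (k <= K0.+1)%N -> y s k ^+ 2 <= B.
  elim: (K0.+1) => [|m [B [B0 hB]]].
    by exists 0; split=> // s [|//] _ _; rewrite /halfwave /= expr0n.
  have [B1 hB1] := y_bounded m.+1.
  exists (B + B1 ^+ 2); split; first by rewrite addr_ge0// sqr_ge0.
  move=> s k hs; rewrite leq_eqVlt => /orP[/eqP ->|hk]; last first.
    by have := hB s k hs hk; have := sqr_ge0 B1; lra.
  have [h _] := hB1 s hs; rewrite -[y s m.+1 ^+ 2]real_normK ?num_real//.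
  have : `|y s m.+1| ^+ 2 <= B1 ^+ 2 by rewrite ler_pXn2r ?nnegrE// (le_trans _ h).
  by lra.
have [B [B0 hB]] := core; exists (6 * B); split; first by lra.
have hy s k : 0 <= s <= rho0 -> y s k ^+ 2 <= 6 * B.
  move=> hs; have hs2 : 0 <= s <= 2.
    by case/andP: hs => h1 h2; rewrite h1 /=; have := rho0_le1; lra.
  case: (leqP k K0) => hk; first by have := hB s k hs2 (leqW hk); lra.
  have := y_tail (k - K0) hs; rewrite subnKC; last exact: ltnW.
  have := hB s K0 hs2 (leqnSn _); have := hB s K0.+1 hs2 (leqnn _).
  by have := sqr_ge0 (y s k.+1); lra.
by move=> s [k|k] hs /=; rewrite ?sqrrN; apply: hy.
Qed.

Let U := cmvU a.

(** When [s^2 = 2 + z + conjc z], the standing wave is killed by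
    [(U - z) (U - conjc z)]; this is its component for [z], up to a factor. *)
Definition wave s z : vect := U (standingC s) - scal (conjc z) (standingC s).

Lemma wave_eigen s z : sqm z = 1 -> s ^+ 2 = 2 + 2 * complex.Re z ->
  U (wave s z) = scal z (wave s z).
Proof.
move=> hz hs; apply: (@quadratic_eigenvector R (cmvU a) (cmvV a)) => //.
- exact: cmvUD.
- exact: cmvUZ.
- exact: (cmvUV oddext_lt1).
have e : cmvU a (standingC s) + cmvV a (standingC s) =
    jac a (jac a (standingC s)) - (standingC s + standingC s).
  by rewrite (jac_jac oddext_lt1) addrK.
rewrite e jac_standing.
have -> : jac a (scal s%:C (standingC s)) = scal s%:C (jac a (standingC s)).
  by apply/funext => n; rewrite /jac /scal; ring.
rewrite jac_standing; apply/funext => n; rewrite /scal !fctE.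
have -> : z + conjc z = (s ^+ 2 - 2)%:C.
  by apply: complexP; rewrite /= ?hs; case: z {hz hs} => z1 z2 /=; ring.
by rewrite rmorphB rmorphXn /= (rmorph_nat (real_complex R) 2); ring.
Qed.

Lemma wave0 s z : wave s z 0 = (s * r 0)%:C.
Proof.
have e : U (standingC s) = scal s%:C (reflL a (standingC s)) - standingC s.
  rewrite -reflLZ -jac_standing -(cmvU_add1 oddext_lt1) addrK //.
rewrite /wave e /scal !fctE /reflL /refl /= /standingC /= /halfwave /=.
by rewrite /r rmorphM /=; ring.
Qed.

Lemma wave_bounded : exists B, 0 <= B /\
  forall s z n, sqm z = 1 -> 0 <= s <= rho0 -> sq (wave s z) n <= B.
Proof.
have [B [B0 hB]] := standing_bounded.
exists (74 * B); split; first by lra.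
move=> s z n hz hs.
have h0 m : sqm (standingC s m) <= B by rewrite sqm_real hB.
have h1 m : sqm (reflM a (standingC s) m) <= 6 * B.
  apply: le_trans (sqm_refl_le _ oddext_lt1 _ _) _.
  by have := h0 m; have := h0 (m + 1); have := h0 (m - 1); lra.
have h2 : sqm (U (standingC s) n) <= 36 * B.
  apply: le_trans (sqm_refl_le _ oddext_lt1 _ _) _.
  by have := h1 n; have := h1 (n + 1); have := h1 (n - 1); lra.
rewrite /sq /wave !fctE; apply: le_trans (sqmD_le _ _) _.
by rewrite sqmN /scal sqmM sqm_conj hz mul1r; have := h0 n; lra.
Qed.

End PlaneWaves.

(** * Ballistic escape for eventually constant coefficients *)

Section Ballistic.
Context {R : realType}.
Local Notation C := R[i].
Local Notation vect := (int -> C).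

(** With [z = e^(2 i x)] and [s = 2 cos x], the arc is an interval of [x]. It
    contains an interval with end points [pi p' / q] and [pi (p' + 1) / q], in
    which [M] consecutive multiples of [pi / (q M)] lie. *)
Lemma frequencies (rho : R) : 0 < rho <= 1 -> exists q, (2 <= q)%N /\
  forall M, (0 < M)%N -> exists (s : 'I_M -> R) (z : 'I_M -> C),
  [/\ forall i, sqm (z i) = 1, forall i, z i ^+ (q * M) = 1, injective z,
      forall i, rho / 2 <= s i <= rho & forall i, s i ^+ 2 = 2 + 2 * complex.Re (z i)].
Proof.
move=> /andP[rho0 rho1].
have b1 : -1 <= rho / 2 <= 1 by apply/andP; split; lra.
have b2 : -1 <= rho / 4 <= 1 by apply/andP; split; lra.
pose x1 := acos (rho / 2); pose x2 := acos (rho / 4).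
have [/andP[x10 x1pi] c1] := acos_def b1; have [/andP[x20 x2pi] c2] := acos_def b2.
have i1 : x1 \in `[0, pi] by rewrite in_itv /= x10 x1pi.
have i2 : x2 \in `[0, pi] by rewrite in_itv /= x20 x2pi.
have [P [P0 PE]] : exists P : R, 0 < P /\ P = pi by exists pi; split=> //; exact: pi_gt0.
have x12 : x1 < x2 by rewrite -(ltr_cos i1 i2) c1 c2; lra.
pose lam := (x2 - x1) / P; have lam0 : 0 < lam by rewrite divr_gt0// subr_gt0.
have [q q2 hq] : exists2 q : nat, (2 <= q)%N & 2 <= q%:R * lam.
  exists (Num.bound (2 / lam)).+2 => //.
  rewrite -ler_pdivrMr//; apply: le_trans (ltW (archi_boundP _)) _.
    by rewrite divr_ge0// ltW.
  by rewrite ler_nat; do 2 apply: leqW.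
have q0 : 0 < q%:R :> R by rewrite ltr0n (leq_trans _ q2).
pose w := q%:R * (x1 / P).
have w0 : 0 <= w by rewrite mulr_ge0 ?divr_ge0// ltW.
have /andP[p1 p2] := truncn_itv w0; set p := Num.truncn w in p1 p2.
(* [p'] is [p.+1], the least integer above [q x1 / pi]. *)
have p3 : p.+1%:R <= w + 1 by rewrite -natr1; lra.
have p4 : p.+2%:R <= q%:R * (x2 / P).
  have -> : q%:R * (x2 / P) = w + q%:R * lam by rewrite /w /lam; field; exact: lt0r_neq0.
  by rewrite -natr1; lra.
exists q; split=> // M M0.
have M0' : 0 < M%:R :> R by rewrite ltr0n.
pose x (i : 'I_M) : R := P * ((p.+1 * M + i)%:R / (q * M)%:R).
have qM : 0 < (q * M)%:R :> R by rewrite natrM mulr_gt0.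
have hx i : x1 <= x i <= x2.
  have e1 : x1 = P * (w / q%:R) by rewrite /w; field; rewrite !lt0r_neq0.
  have e2 : x2 = P * (q%:R * (x2 / P) / q%:R) by field; rewrite !lt0r_neq0.
  rewrite {1}e1 [X in _ <= _ <= X]e2 /x !ler_pM2l// ler_pdivlMr// natrM.
  rewrite -[w / _ * _]mulrA mulKf ?lt0r_neq0// -[X in _ && X]ler_pdivlMr ?invr_gt0 ?mulr_gt0//.
  rewrite invrK -[_ / q%:R * _]mulrA mulKf ?lt0r_neq0// natrD natrM.
  have i0 : 0 <= (i : nat)%:R :> R by [].
  have i3 : (i : nat)%:R <= M%:R :> R by rewrite ler_nat ltnW.
  have a1 : w * M%:R <= p.+1%:R * M%:R by rewrite ler_pM2r// ltW.
  have a2 : p.+2%:R * M%:R <= q%:R * (x2 / P) * M%:R by rewrite ler_pM2r.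
  move: a2; rewrite -natr1 mulrDl mul1r => a2.
  by apply/andP; split; lra.
have ix i : x i \in `[0, pi].
  by have /andP[h1 h2] := hx i; rewrite in_itv /= (le_trans x10 h1) (le_trans h2 x2pi).
have mono (u v : R) : u \in `[0, pi] -> v \in `[0, pi] -> u <= v -> cos v <= cos u.
  move=> hu hv; rewrite le_eqVlt => /orP[/eqP -> //|h]; apply: ltW.
  by rewrite (ltr_cos hu hv).
have hc i : rho / 4 <= cos (x i) <= rho / 2.
  have /andP[h1 h2] := hx i; rewrite -c1 -c2.
  by apply/andP; split; apply: mono.
have he i : complex.Re (expi (2 * x i)) = 2 * cos (x i) ^+ 2 - 1.
  by rewrite /= mulr_natl cos_mulr2n mulr_natl.
exists (fun i => 2 * cos (x i)), (fun i => expi (2 * x i)); split.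
- by move=> i; exact: sqm_expi.
- move=> i; rewrite expiX.
  have -> : (q * M)%:R * (2 * x i) = (p.+1 * M + i)%:R * (2 * P).
    rewrite /x; move: ((q * M)%:R) qM => Z Z0; field; exact: lt0r_neq0.
  by rewrite -expiX PE expi_2pi expr1n.
- move=> i j e; have := congr1 (@complex.Re R) e; rewrite !he => e1.
  have /andP[ci _] := hc i; have /andP[cj _] := hc j.
  have : cos (x i) ^+ 2 = cos (x j) ^+ 2 by lra.
  move=> /eqP; rewrite eqrXn2//; [|lra|lra] => /eqP /(cos_inj (ix i) (ix j)) /(mulfI (lt0r_neq0 P0)).
  move=> /(mulIf _) => /(_ _); rewrite invr_neq0 ?lt0r_neq0// => /(_ isT) /eqP.
  by rewrite eqr_nat eqn_add2l => /eqP h; apply: val_inj.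
- by move=> i; have /andP[h1 h2] := hc i; apply/andP; split; lra.
- by move=> i; rewrite he; ring.
Qed.

Variable b : nat -> R.
Hypothesis b_lt1 : forall k, `|b k| < 1.
Variable K0 : nat.
Hypothesis b_const : forall k, (K0 <= k)%N -> b k = b K0.

Let a := oddext b.
Let a_lt1 : forall n, `|a n| < 1 := oddext_lt1 b_lt1.
Let G t := iter t (cmvU a) (delta R 0).

Let l2G t : l2 (G t).
Proof. by elim: t => [|t ih] /=; [exact: l2_delta|exact: l2_cmvU]. Qed.

Let nsqG t : nsq (G t) = 1.
Proof. by elim: t => [|t ih] /=; [exact: nsq_delta|rewrite nsq_cmvU]. Qed.

Lemma trunc_trunc (K N : nat) (psi : vect) : (K <= N)%N -> trunc K (trunc N psi) = trunc K psi.
Proof.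
move=> h; apply/funext => n; rewrite /trunc; case: ifPn => // hn.
by rewrite (in_window_le h hn).
Qed.

(** Cauchy-Schwarz, separately inside and outside the smaller window. *)
Lemma overlap_le (psi g : vect) (K W : nat) : l2 g -> nsq g = 1 -> (K <= W)%N ->
  sqm (psum (fun n => conjc (psi n) * g n) W) <=
  2 * psum (sq psi) K + 2 * nsq (g - trunc K g) * psum (sq psi) W.
Proof.
move=> hg ng hK; rewrite -l2dot_trunc.
have hW := l2_trunc W psi; have hgK := l2_trunc K g; have hgc := l2B hg hgK.
have -> : l2dot (trunc W psi) g = l2dot (trunc K psi) g + l2dot (trunc W psi) (g - trunc K g).
  rewrite -(trunc_trunc psi hK) (dot_trunc K hW hg) -dotDr//.
  by congr l2dot; rewrite addrC subrK.
apply: le_trans (sqmD_le _ _) _.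
have h1 := cauchy_schwarz (l2_trunc K psi) hg; rewrite ng mulr1 nsq_trunc in h1.
have h2 := cauchy_schwarz hW hgc; rewrite nsq_trunc in h2.
lra.
Qed.

(** The packet [psi t] superposes [M] waves. Summed over the [N] times, its mass
    in a window is at most proportional to the size of the window ([pars]), while
    its overlap with [G t] does not depend on [t] ([mass]). If [G t] always had
    little mass outside the window of size [K], the overlap would come from the
    packet inside it, and [K] is too small a fraction of [N] for that. *)
Let spread : exists (eta : R) (h q : nat), [/\ 0 < eta, (0 < h)%N, (0 < q)%N &
  forall K, (0 < K)%N -> exists t, [/\ (h * K <= t)%N, (t < q * (h * K))%N &
    eta <= nsq (G t - trunc K (G t))]].
Proof.
pose rho := rr a (Posz K0).
have rho01 : 0 < rho <= 1 by rewrite (rr_gt0 a_lt1) (rr_le1 a_lt1).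
have [q [q2 freq]] := frequencies rho01.
have [B [B0 hB]] := wave_bounded b_lt1 b_const.
pose mu := rho / 2 * rr a (Posz 0).
have mu0 : 0 < mu by rewrite mulr_gt0 ?(rr_gt0 a_lt1)// divr_gt0// (rr_gt0 a_lt1).
have q0 : 0 < q%:R :> R by rewrite ltr0n (leq_trans _ q2).
(* [h] and [eta] make each of the two terms of the final estimate at most a
   quarter of the left-hand side. *)
pose h := (Num.bound (16 * q%:R * B / mu ^+ 2)).+1.
have hh : 16 * q%:R * B <= h%:R * mu ^+ 2.
  rewrite -ler_pdivrMr ?exprn_gt0//; apply: le_trans (ltW (archi_boundP _)) _.
    by apply: divr_ge0; [do 2 apply: mulr_ge0 => //; exact: ltW|exact: sqr_ge0].
  by rewrite ler_nat.
pose eta := mu ^+ 2 / (48 * q%:R ^+ 2 * (B + 1)).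
have eta0 : 0 < eta.
  by rewrite divr_gt0 ?exprn_gt0// mulr_gt0 ?mulr_gt0 ?exprn_gt0//; lra.
exists eta, h, q; split=> //; first by lia.
move=> K K0'; apply: contrapT => hn.
pose M := (h * K)%N; pose N := (q * M)%N; pose W := (2 * N).+1.
have M0 : (0 < M)%N by rewrite muln_gt0 K0'.
have [s [z [hz zN zinj hs hsz]]] := freq M M0.
pose phi i := wave b (s i) (z i).
have phiE i : cmvU a (phi i) = scal (z i) (phi i) by exact: wave_eigen.
have hs0 i : 0 <= s i <= rho.
  by have /andP[h1 h2] := hs i; rewrite h2 andbT; have /andP[? _] := rho01; lra.
have phiB i n : sq (phi i) n <= B by apply: hB.
pose psi t : vect := fun n => \sum_i z i ^+ t * phi i n.
have out t : (M <= t)%N -> (t < N)%N -> nsq (G t - trunc K (G t)) <= eta.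
  move=> h1 h2; rewrite leNgt; apply/negP => h3; apply: hn.
  by exists t; split=> //; exact: ltW.
have KN : (K <= N)%N by rewrite /N /M; nia.
have mass t : (t < N)%N ->
    psum (fun n => conjc (psi t n) * G t n) W = (\sum_i s i * rr a (Posz 0))%:C.
  move=> tN.
  transitivity (\sum_i conjc (z i ^+ t) * psum (fun n => conjc (phi i n) * G t n) W).
    rewrite -(eq_psum (u := fun n => \sum_i conjc (z i ^+ t) * (conjc (phi i n) * G t n))).
      rewrite psum_sum; apply: eq_bigr => i _.
      by rewrite /psum mulr_sumr; apply: eq_bigr => k _; rewrite mulrDr.
    move=> n; rewrite /psi conj_sum mulr_suml; apply: eq_bigr => i _.
    by rewrite conjM mulrA.
  rewrite rmorph_sum /=; apply: eq_bigr => i _.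
  rewrite (psum_eigen a_lt1 (phiE i) (hz i)); last by rewrite /W; lia.
  by rewrite mulrA conj_mul sqmX hz expr1n mul1r /phi (wave0 b_lt1) conjc_real.
have low : (M%:R * mu) ^+ 2 <= (\sum_i s i * rr a (Posz 0)) ^+ 2.
  have hm : M%:R * mu <= \sum_i s i * rr a (Posz 0).
    rewrite -[X in X%:R * _]card_ord mulr_natl -sumr_const; apply: ler_sum => i _.
    by rewrite /mu ler_pM2r ?(rr_gt0 a_lt1)//; have /andP[] := hs i.
  have hm0 : 0 <= M%:R * mu by rewrite mulr_ge0// ltW.
  by rewrite ler_pXn2r ?nnegrE// (le_trans hm0 hm).
have each t : (M <= t)%N -> (t < N)%N ->
    (M%:R * mu) ^+ 2 <= 2 * psum (sq (psi t)) K + 2 * eta * psum (sq (psi t)) W.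
  move=> h1 h2; apply: le_trans low _; rewrite -sqm_real -(mass t h2).
  apply: le_trans (overlap_le _ (l2G t) (nsqG t) (_ : (K <= W)%N)) _; first by rewrite /W; lia.
  rewrite lerD2l; apply: ler_wpM2r; first by apply: psum_ge0; exact: sq_ge0.
  by apply: ler_wpM2l => //; exact: out.
have pars L : \sum_(t < N) psum (sq (psi t)) L <= (2 * L)%:R * (N%:R * (M%:R * B)).
  rewrite -psum_sum; apply: le_trans (_ : psum (fun=> N%:R * (M%:R * B)) L <= _).
    apply: le_psum => n; rewrite /sq /psi (parseval _ hz)//.
    apply: ler_wpM2l => //; rewrite -[X in X%:R * _]card_ord mulr_natl -sumr_const.
    by apply: ler_sum => i _; exact: phiB.
  by rewrite /psum sumr_const_nat subn0 mulnC natrM -mulrA !mulr_natl mulr2n.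
have total : (N - M)%:R * (M%:R * mu) ^+ 2 <=
    2 * ((2 * K)%:R * (N%:R * (M%:R * B))) + 2 * eta * ((2 * W)%:R * (N%:R * (M%:R * B))).
  apply: le_trans (_ : \sum_(M <= t < N) (M%:R * mu) ^+ 2 <= _).
    by rewrite sumr_const_nat mulr_natl.
  apply: le_trans (_ : \sum_(M <= t < N)
     (2 * psum (sq (psi t)) K + 2 * eta * psum (sq (psi t)) W) <= _).
    by apply: ler_sum_nat => t /andP[]; exact: each.
  have MN : (M <= N)%N by rewrite /N; nia.
  apply: le_trans (_ : \sum_(0 <= t < N)
     (2 * psum (sq (psi t)) K + 2 * eta * psum (sq (psi t)) W) <= _).
    rewrite [leRHS](big_cat_nat (n := M))//= lerDr; apply: sumr_ge0 => t _.
    have p1 := psum_ge0 K (sq_ge0 (psi t)); have p2 := psum_ge0 W (sq_ge0 (psi t)).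
    by rewrite addr_ge0// mulr_ge0// mulr_ge0// ltW.
  rewrite big_mkord big_split /= -!mulr_sumr; apply: lerD.
    by rewrite ler_wpM2l.
  by apply: ler_wpM2l; [rewrite mulr_ge0// ltW|exact: pars].
have hNM : M%:R <= (N - M)%:R :> R by rewrite ler_nat /N; nia.
have hW : (2 * W)%:R <= 6 * N%:R :> R by rewrite -natrM ler_nat /W /N; nia.
have eN : N%:R = q%:R * M%:R :> R by rewrite /N natrM.
have eM : M%:R = h%:R * K%:R :> R by rewrite /M natrM.
have m0 : 0 < M%:R :> R by rewrite ltr0n.
have k0 : 0 < K%:R :> R by rewrite ltr0n.
have m2 : 0 < mu ^+ 2 by rewrite exprn_gt0.
(* Both terms on the right are at most [M^3 mu^2 / 4]. *)
have t1 : 2 * ((2 * K)%:R * (N%:R * (M%:R * B))) <= M%:R ^+ 3 * mu ^+ 2 / 4.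
  rewrite natrM eN.
  have -> : 2 * (2%:R * K%:R * (q%:R * M%:R * (M%:R * B))) =
     (M%:R ^+ 2 * K%:R / 4) * (16 * q%:R * B) by field.
  have -> : M%:R ^+ 3 * mu ^+ 2 / 4 = (M%:R ^+ 2 * K%:R / 4) * (h%:R * mu ^+ 2).
    by rewrite exprSr {2}eM; field.
  by rewrite ler_wpM2l// divr_ge0// mulr_ge0// exprn_ge0.
have t2 : 2 * eta * ((2 * W)%:R * (N%:R * (M%:R * B))) <= M%:R ^+ 3 * mu ^+ 2 / 4.
  apply: le_trans (_ : 2 * eta * (6 * N%:R * (N%:R * (M%:R * (B + 1)))) <= _).
    apply: ler_wpM2l; first by rewrite mulr_ge0// ltW.
    apply: ler_pM => //; first by rewrite !mulr_ge0.
    by do 2 apply: ler_wpM2l => //; lra.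
  rewrite le_eqVlt; apply/orP; left; apply/eqP; rewrite eN /eta; field.
  by apply/andP; split; [lra|exact: lt0r_neq0].
have t3 : M%:R ^+ 3 * mu ^+ 2 <= (N - M)%:R * (M%:R * mu) ^+ 2.
  rewrite (_ : M%:R ^+ 3 * mu ^+ 2 = M%:R * (M%:R * mu) ^+ 2); last by ring.
  by rewrite ler_wpM2r// sqr_ge0.
have : 0 < M%:R ^+ 3 * mu ^+ 2 by rewrite mulr_gt0// exprn_gt0.
lra.
Qed.

Lemma position_ge (psi : vect) (K : nat) : l2 psi ->
  0 < nsq (psi - trunc K psi) ->
  ((K%:R ^+ 2 * (nsq (psi - trunc K psi) / 2))%:E <= l2sq (position psi))%E.
Proof.
move=> h n0; have hc : l2 (psi - trunc K psi) by apply: l2B => //; exact: l2_trunc.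
have e0 : 0 < nsq (psi - trunc K psi) / 2 by rewrite divr_gt0.
have [N hN] := sumZ_tail (sq_ge0 (psi - trunc K psi)) hc e0.
apply: le_trans (psum_le_l2sq (position psi) N); rewrite lee_fin.
apply: le_trans (_ : K%:R ^+ 2 * psum (sq (psi - trunc K psi)) N <= _).
  apply: ler_wpM2l; first exact: sqr_ge0.
  by have := hN N (leqnn _); rewrite -/(nsq _); lra.
rewrite -psumZ; apply: le_psum => n; rewrite /sq !fctE /trunc.
case: ifPn => hn; first by rewrite subrr sqm0 mulr0 sqm_ge0.
rewrite subr0 /position sqmM; apply: ler_wpM2r; first exact: sqm_ge0.
have -> : sqm (n%:~R : C) = (`|n|%N)%:R ^+ 2.
  have -> : (n%:~R : C) = (n%:~R : R)%:C by rewrite rmorph_int.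
  by rewrite sqm_real -[in LHS]real_normK ?num_real// -intr_norm -abszE.
rewrite ler_pXn2r ?nnegrE ?ler0n// ler_nat.
by move: hn; rewrite in_windowE; lia.
Qed.

(** The mass found by [spread] is outside a window whose size is a fixed fraction
    of [t]. *)
Theorem ballistic : exists2 c : R, 0 < c & forall T0 : nat, exists t : nat,
  [/\ (T0 <= t)%N, (0 < t)%N &
   ((c * t%:R ^+ 2)%:E <= l2sq (position (iter t (cmvU a) (delta R 0%R))))%E].
Proof.
have [eta [h [q [eta0 h0 q0 H]]]] := spread.
have hq0 : 0 < (q * h)%:R :> R by rewrite ltr0n muln_gt0 q0.
exists (eta / 2 / (q * h)%:R ^+ 2); first by rewrite !divr_gt0// exprn_gt0.
move=> T0; have [t [t1 t2 t3]] := H T0.+1 (ltn0Sn _).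
exists t; split; [nia|nia|].
have n0 := lt_le_trans eta0 t3.
apply: le_trans (position_ge (l2G t) n0); rewrite lee_fin.
have e1 : t%:R ^+ 2 <= (q * h)%:R ^+ 2 * T0.+1%:R ^+ 2 :> R.
  by rewrite -exprMn -natrM ler_pXn2r ?nnegrE ?ler0n// ler_nat; nia.
apply: le_trans (_ : eta / 2 * T0.+1%:R ^+ 2 <= _).
  rewrite -mulrA; apply: ler_wpM2l; first by rewrite divr_ge0// ltW.
  by rewrite mulrC ler_pdivrMr ?exprn_gt0// mulrC.
by rewrite mulrC ler_wpM2l ?sqr_ge0//; lra.
Qed.

End Ballistic.

(** * The staircase of coefficients *)

Section Construction.
Context {R : realType}.
Local Notation C := R[i].
Local Notation vect := (int -> C).

Lemma refl_agree start (a a' : int -> R) (psi : vect) j : supported j psi ->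
  (forall n : int, (`|n| <= j.+1)%N -> a n = a' n) -> refl start a psi = refl start a' psi.
Proof.
move=> h e; apply/funext => n; rewrite /refl /rr.
case: (leqP `|n|%N j.+1) => hn; last first.
  have p0 : psi n = 0 by apply: h; lia.
  have p1 : psi (n + 1) = 0 by apply: h; lia.
  have p2 : psi (n - 1) = 0 by apply: h; lia.
  by rewrite p0 p1 p2 !mulr0.
rewrite e//; case: (leqP `|n - 1|%N j.+1) => hn1; first by rewrite e.
have p0 : psi n = 0 by apply: h; lia.
have p2 : psi (n - 1) = 0 by apply: h; lia.
by rewrite p0 p2 !mulr0.
Qed.

(** Each reflection enlarges the support by one site, so that the first [t] steps
    read the coefficients up to [t.*2] only. *)
Lemma iter_agree (a a' : int -> R) t : (forall n : int, (`|n| <= t.*2)%N -> a n = a' n) ->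
  iter t (cmvU a) (delta R 0) = iter t (cmvU a') (delta R 0).
Proof.
elim: t => // t ih h; rewrite !iterS -ih; last by move=> n hn; apply: h; lia.
have hs := @supported_iter R a t.
rewrite /cmvU /reflL /reflM (refl_agree _ hs (a' := a')); last by move=> n hn; apply: h; lia.
by apply: refl_agree (supported_refl _ _ hs) _ => n hn; apply: h; lia.
Qed.

Lemma limn_esup_pinfty (u : nat -> \bar R) :
  (forall k : nat, exists2 t, (k <= t)%N & (k%:R%:E <= u t)%E) -> limn_esup u = +oo%E.
Proof.
move=> h; rewrite /limn_esup limf_esupE; apply/ereal_inf_pinfty => _ [V [N _ hN] <-] /=.
apply/eqyP => x x0.
pose k := (Num.bound x + N)%N; have [t kt ut] := h k.
apply: le_trans (_ : (u t <= _)%E); last first.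
  by apply: ereal_sup_ubound; exists t => //; apply: hN => /=; apply: leq_trans kt; rewrite leq_addl.
apply: le_trans ut; rewrite lee_fin; apply: le_trans (ltW (archi_boundP (ltW x0))) _.
by rewrite ler_nat leq_addr.
Qed.

Definition level k : R := 1 - (k.+2%:R)^-1.

Lemma level_ge0 k : 0 <= level k.
Proof. by rewrite subr_ge0 invf_le1 ?ltr0n// ler1n. Qed.

Lemma level_lt1 k : level k < 1.
Proof. by rewrite gtrBl invr_gt0 ltr0n. Qed.

Lemma level_nd j k : (j <= k)%N -> level j <= level k.
Proof. by move=> h; rewrite lerD2l lerN2 lef_pV2 ?posrE ?ltr0n// ler_nat. Qed.

Lemma level_lim e : 0 < e -> exists k, 2 * (1 - level k) <= e.
Proof.
move=> e0; have p : 0 < 2 / e by rewrite divr_gt0.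
have hk := archi_boundP (ltW p); set k := Num.bound _ in hk; exists k.
have -> : 1 - level k = k.+2%:R^-1 by rewrite /level opprB addrC subrK.
rewrite ler_pdivrMr ?ltr0n// mulrC -ler_pdivrMr//; apply: le_trans (ltW hk) _.
by rewrite ler_nat; do 2 apply: leqW.
Qed.

(** The equal pairs are what [range_dense] asks for; oddness gives [ballistic] its
    odd standing waves. *)
Definition coeff (g : nat -> R) : int -> R := oddext (fun m => g m./2).

Lemma coeff_paired g n : (2 %| n)%Z -> coeff g (n + 1) = coeff g n.
Proof.
rewrite /coeff; case: n => [m|m] h.
  have -> : Posz m + 1 = Posz m.+1 by lia.
  by rewrite /=; congr g; lia.
case: m h => [|m] h; first by lia.
have -> : Negz m.+1 + 1 = Negz m by lia.
by rewrite /=; congr (- g _); lia.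
Qed.

Lemma coeff_vanishing g : (forall m, 0 <= g m < 1) ->
  (forall k, exists N, forall m, (N <= m)%N -> level k <= g m) ->
  forall e, 0 < e -> exists N, forall n, ~~ in_window N n -> weight (coeff g) n <= e.
Proof.
move=> g01 hg; apply: weight_vanishing => e e0.
have [k hk] := level_lim e0; have [N hN] := hg k.
exists (2 * N).+2 => n hn.
have l0 := level_ge0 k; have l1 := level_lt1 k.
have sqr_small (x : R) : level k <= x < 1 -> 1 - x ^+ 2 <= e.
  by move=> /andP[x0 x1]; rewrite expr2; nra.
have dif_small (x y : R) : level k <= x < 1 -> level k <= y < 1 -> (x - y) ^+ 2 <= e.
  by move=> /andP[x0 x1] /andP[y0 y1]; rewrite expr2; nra.
have gk m : (N <= m)%N -> level k <= g m < 1.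
  by move=> h; rewrite hN//; have /andP[] := g01 m.
have c1 m : `|coeff g m| < 1.
  apply: oddext_lt1 => j; have /andP[h1 h2] := g01 j./2; by rewrite ger0_norm.
rewrite rr_sqr// /diag /coeff; case: n hn => m; rewrite [in_window _ _]/= -leqNgt => hm.
  have -> : Posz m - 1 = Posz m.-1 by lia.
  by split; [apply: sqr_small; apply: gk; lia|apply: dif_small; apply: gk; lia].
have -> : Negz m - 1 = Negz m.+1 by lia.
rewrite /= sqrrN; split; first by apply: sqr_small; apply: gk; lia.
by rewrite opprK addrC; apply: dif_small; apply: gk; lia.
Qed.

Variable f : R -> R.
Hypothesis f_pos : forall t : R, 0 < t -> 0 < f t.
Hypothesis f_infty : f t @[t --> +oo%R] --> +oo%R.

Definition spreading (a : int -> R) (t : nat) : \bar R :=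
  ((f t%:R / t%:R ^+ 2)%:E * l2sq (position (iter t (cmvU a) (delta R 0%R))))%E.

Lemma spreading_large g N k : (forall m, 0 <= g m < 1) ->
  (forall m, (N <= m)%N -> g m = level k) ->
  exists2 t, (k <= t)%N & (k%:R%:E <= spreading (coeff g) t)%E.
Proof.
move=> g01 gN.
have b1 m : `|g m./2| < 1 by have /andP[? ?] := g01 m./2; rewrite ger0_norm.
have bc m : (2 * N <= m)%N -> g m./2 = g (2 * N)./2 by move=> h; rewrite !gN//; lia.
have [c c0 H] := ballistic b1 bc.
have [T [_ hT]] := (cvgryPge f).1 f_infty (k%:R / c).
have [t [t1 t0 t2]] := H (Num.bound `|T| + k).+1.
exists t; first by apply: leq_trans t1; rewrite leqW// leq_addl.
have tR : 0 < t%:R :> R by rewrite ltr0n.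
have fT : k%:R / c <= f t%:R.
  apply: hT; apply: le_lt_trans (ler_norm T) _.
  apply: lt_le_trans (archi_boundP (normr_ge0 T)) _.
  by rewrite ler_nat; apply: leq_trans t1; rewrite leqW// leq_addr.
apply: le_trans (_ : ((f t%:R / t%:R ^+ 2)%:E * (c * t%:R ^+ 2)%:E <= _)%E); last first.
  by apply: lee_wpmul2l t2; rewrite lee_fin divr_ge0 ?sqr_ge0// ltW// f_pos.
rewrite -EFinM lee_fin.
have -> : f t%:R / t%:R ^+ 2 * (c * t%:R ^+ 2) = c * f t%:R.
  by field; exact: lt0r_neq0.
by rewrite mulrC -ler_pdivrMr.
Qed.

Definition stage_ok k (s : (nat -> R) * nat) :=
  (forall m, 0 <= s.1 m < 1) /\ forall m, (s.2 <= m)%N -> s.1 m = level k.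

Definition extend k (s : (nat -> R) * nat) N : (nat -> R) * nat :=
  (fun m => if (m < N)%N then s.1 m else level k.+1, N).

(** Long plateaus: each stage waits, with its last level kept for ever, for a time
    at which the spreading is large, and only then raises the level, too far
    out to be noticed by that time. *)
Theorem staircase : exists g : nat -> R, [/\ forall m, 0 <= g m < 1,
  forall k, exists N, forall m, (N <= m)%N -> level k <= g m &
  forall k, exists2 t, (k <= t)%N & (k%:R%:E <= spreading (coeff g) t)%E].
Proof.
have ex (x : nat * ((nat -> R) * nat)) : exists N, stage_ok x.1 x.2 ->
    (x.2.2 < N)%N /\ exists2 t, (x.1 <= t)%N &
    (t < N)%N /\ (x.1%:R%:E <= spreading (coeff x.2.1) t)%E.
  case: x => k [g N] /=.
  have [[h1 h2]|hn] := pselect (stage_ok k (g, N)); last by exists 0%N.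
  have [t t1 t2] := spreading_large h1 h2.
  exists (N + t).+1 => _; split; first by rewrite ltnS leq_addr.
  by exists t => //; split=> //; rewrite ltnS leq_addl.
have [F hF] := choice ex.
pose st := fix st k := if k is j.+1 then extend j (st j) (F (j, st j)) else (fun=> level 0, 0%N).
have ok k : stage_ok k (st k).
  elim: k => [|k [h1 h2]]; first by split=> //= m; rewrite level_ge0 level_lt1.
  have [hN _] := hF (k, st k) (conj h1 h2).
  split=> m /=; first by case: ifP => // _; rewrite level_ge0 level_lt1.
  by rewrite ltnNge => ->.
pose G k := (st k).1; pose N k := (st k).2.
have GS k m : G k.+1 m = if (m < N k.+1)%N then G k m else level k.+1 by [].
have NS k : (N k < N k.+1)%N by have [] := hF (k, st k) (ok k).
have Nmono j k : (j <= k)%N -> (N j <= N k)%N.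
  elim: k => [|k ih]; first by rewrite leqn0 => /eqP ->.
  by rewrite leq_eqVlt => /orP[/eqP ->//|/ih h]; apply: leq_trans h (ltnW _).
have Nk k : (k <= N k)%N by elim: k => // k ih; apply: leq_ltn_trans ih (NS k).
have stable j k m : (k <= j)%N -> (m < N k.+1)%N -> G j m = G k m.
  elim: j => [|j ih]; first by rewrite leqn0 => /eqP ->.
  rewrite leq_eqVlt => /orP[/eqP ->//|hk hm]; rewrite GS ih//.
  by rewrite (leq_trans hm)//; apply: Nmono.
pose g m := G m m.
have gE k m : (m < N k.+1)%N -> g m = G k m.
  move=> hm; have hm' : (m < N m.+1)%N by exact: Nk.
  by rewrite /g -(stable (maxn m k) m)// ?leq_maxl// (stable (maxn m k) k)// leq_maxr.
exists g; split.
- by move=> m; have [h _] := ok m; apply: h.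
- move=> k; exists (N k) => m hm.
  have key j : (k <= j)%N -> level k <= G j m.
    elim: j => [|j ih]; rewrite leq_eqVlt => /orP[/eqP e|hj] //.
    + by rewrite -e; have [_ h] := ok k; rewrite /G h.
    + by rewrite -e; have [_ h] := ok k; rewrite /G h.
    + by rewrite GS; case: ifP => _; [exact: ih|exact: level_nd (ltnW hj)].
  by apply: key; apply: leq_trans hm.
- move=> k; have [_ [t t1 [t2 t3]]] := hF (k, st k) (ok k).
  exists t => //; move: t3; rewrite /spreading /=.
  rewrite (@iter_agree (coeff (st k).1) (coeff g))// => n hn.
  have ht m : (m <= t.*2)%N -> (st k).1 m./2 = g m./2.
    by move=> hm; rewrite (gE k)//; apply: leq_ltn_trans t2; lia.
  by rewrite /coeff; case: n hn => m hm /=; rewrite ht//; lia.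
Qed.

End Construction.

Theorem theorem1p2 (R : realType) (f : R -> R)
    (f_pos : forall t : R, 0 < t -> 0 < f t)
    (f_incr : forall s t : R, 0 < s -> s <= t -> f s <= f t)
    (f_infty : f t @[t --> +oo%R] --> +oo%R) :
  exists alpha : int -> R[i],
    [/\ forall n : int, cabs (alpha n) < 1,
        pure_point_exp_decaying (ecmv alpha)
      & limn_esup (fun t : nat =>
          ((f t%:R / t%:R ^+ 2)%:E *
            l2sq (position (iter t (ecmv alpha) (delta R 0))))%E) = +oo%E].
Proof.
have [g [g01 glim gspread]] := staircase f_pos f_infty.
have c1 n : `|coeff g n| < 1.
  by apply: oddext_lt1 => m; have /andP[? ?] := g01 m./2; rewrite ger0_norm.
exists (fun n => (coeff g n)%:C); split.
- by move=> n; rewrite cabs_sqm sqm_real sqrtr_sqr.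
- apply: cmv_pure_point => //; first exact: coeff_vanishing.
  exact: coeff_paired.
- by rewrite ecmvE; apply: limn_esup_pinfty => k; apply: gspread.
Qed.
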